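(* Let $(E,C)$ be a finite bipartite separated graph satisfying condition (L), let $K$ be a field with involution and $\mathbb F$ the free group on $E^1$. Consider the $*$-algebra $L^{\mathrm{ab}}(E,C)=C_K(\Omega(E,C))\rtimes_\alpha\mathbb F$. Given a nonzero element $a$ in $L^{\mathrm{ab}}(E,C)$, there is a nonzero projection $h$ in $C_K(\Omega(E,C))$, a nonzero element $\lambda\in K$ and an element $g\in\mathbb F$ such that $$ha(e(g)\delta_g)h=\lambda h\delta_e.$$ In particular every nonzero ideal of $L^{\mathrm{ab}}(E,C)$ contains a nonzero projection of $C_K(\Omega(E,C))$.
   Context: A separated graph is a pair $(E,C)$, where $E=(E^0,E^1,r,s)$ is a directed graph and $C=\bigsqcup_{v\in E^0}C_v$ with $C_v$ a partition of $r^{-1}(v)$ into nonempty subsets ($C_v=\emptyset$ if $r^{-1}(v)=\emptyset$). It is finite if $E^0,E^1$ are finite, and bipartite if $E^0=E^{0,0}\sqcup E^{0,1}$ with all arrows going from $E^{0,1}$ to $E^{0,0}$, $r(E^1)=E^{0,0}$ and $s(E^1)=E^{0,1}$. For $x\in E^1$, $X_x$ is the unique element of $C$ containing $x$. An $(E,C)$-dynamical system is a compact Hausdorff space $\Omega$ with clopen subsets $\Omega_v$ ($v\in E^0$) with $\Omega=\bigsqcup_{v\in E^0}\Omega_v$, for each $v\in E^{0,0}$ clopen subsets $H_x\subseteq\Omega_v$ ($x\in r^{-1}(v)$) with $\Omega_v=\bigsqcup_{x\in X}H_x$ for all $X\in C_v$, and homeomorphisms $\theta_x\colon\Omega_{s(x)}\to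 H_x$ for all $x\in E^1$. A map $f$ between such systems is equivariant if $f(\Omega_w)\subseteq\Omega'_w$ ($w\in E^0$), $f(H_x)\subseteq H'_x$ and $f\circ\theta_x=\theta'_x\circ f$ on $\Omega_{s(x)}$ ($x\in E^1$). $\Omega(E,C)$ is the universal $(E,C)$-dynamical system: the one to which every $(E,C)$-dynamical system admits a unique continuous equivariant map; it exists, is unique up to isomorphism, and is a zero-dimensional metrizable compact space. The canonical partial action of $\mathbb F$ on it: for a reduced word $g=g_1\cdots g_k$ in letters $x^{\pm1}$, $\theta_g=\theta_{g_1}\circ\cdots\circ\theta_{g_k}$ (composition of partial homeomorphisms on the largest possible domain, $\theta_{x^{-1}}=\theta_x^{-1}$), $\theta_g\colon U_{g^{-1}}\to U_g$ with all $U_g$ clopen. $C_K(\Omega(E,C))$ is the $*$-algebra of continuous functions $\Omega(E,C)\to K$, $K$ discrete. $e(g)$ is the characteristic function of $U_g$, $\mathcal D_g=e(g)C_K(\Omega(E,C))$, $\alpha_g\colon\mathcal D_{g^{-1}}\to\mathcal D_g$, $\alpha_g(f)=f\circ\theta_{g^{-1}}$ on $U_g$, zero elsewhere. The crossed product consists of finite formal sums $\sum_ga_g\delta_g$, $a_g\in\mathcal D_g$, with $(a_g\delta_g)(b_h\delta_h)=\alpha_g(\alpha_{g^{-1}}(a_g)b_h)\delta_{gh}$, $(a_g\delta_g)^*=\alpha_{g^{-1}}(a_g^* )\delta_{g^{-1}}$. In $\delta_e$, $e$ denotes the identity of $\mathbb F$, and $h\in C_K(\Omega(E,C))$ is identified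 with $h\delta_e$. (This crossed product is isomorphic to the quotient of the Leavitt path algebra $L_K(E,C)$ by the ideal generated by commutators of final projections $ww^*$ of words $w$ in $E^1\cup(E^1)^*$.) Condition (L). Paths are taken in the double $\hat E$ of $E$, obtained by adding for each $e\in E^1$ an edge $e^*$ with $s(e^* )=r(e)$, $r(e^* )=s(e)$; paths are written right to left. A path $e_{2r}^*e_{2r-1}\cdots e_4^*e_3e_2^*e_1$ is admissible if $X_{e_{2i-1}}\ne X_{e_{2i}}$ for $i=1,\dots,r$ and $e_{2i+1}\ne e_{2i}$ for $i=1,\dots,r-1$; the same definition applies to paths $e_{2r-1}\cdots e_4^*e_3e_2^*e_1$. A closed path in $(E,C)$ is a non-trivial admissible path $\gamma=e_{2r}^*e_{2r-1}\cdots e_2^*e_1$ with $s(e_1)=s(e_{2r})$. A cycle is a closed path such that $e_1\neq e_{2r}$ and $s(e_{2i-1})\ne s(e_{2j})$ for all $1\le i\le j<r$. An entry of a closed path $\gamma$ is a non-trivial admissible path $x_{2t-1}x_{2t-2}^*\cdots x_3x_2^*x_1$ such that $s(x_1)=s(e_1)$ and $|X|\ge2$ for some $X\in C_{r(x_{2t-1})}$ with $X\ne X_{x_{2t-1}}$. $(E,C)$ satisfies condition (L) if every cycle has an entry. *)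

(* Defs.v *)
From HB Require Import structures.
From mathcomp Require Import all_boot all_order all_algebra.
From mathcomp Require Import all_classical.
From mathcomp Require Import topology numfun.

Set Implicit Arguments.
Unset Strict Implicit.
Unset Printing Implicit Defensive.

Import GRing.Theory.
Local Open Scope classical_set_scope.
Local Open Scope ring_scope.

(** * The free group on a set, as the group of reduced words *)

Section FreeGroup.
Variable A : choiceType.

(* [(x, false)] is the letter [x] and [(x, true)] the letter [x^-1]. *)
Local Notation letter := (A * bool)%type.

Definition linv (l : letter) : letter := (l.1, ~~ l.2).

Definition reduced (w : seq letter) : bool :=
  sorted (fun l m => m != linv l) w.

Record freegroup := FreeGroup { fgword : seq letter; _ : reduced fgword }.

HB.instance Definition _ := [isSub for fgword].
HB.instance Definition _ := [Choice of freegroup by <:].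

Lemma fgwordP (g : freegroup) : reduced (fgword g). Proof. by case: g. Qed.

(* [push l w] is the reduced form of [l :: w], for [w] reduced. *)
Definition push (l : letter) (w : seq letter) : seq letter :=
  if w is m :: w' then if m == linv l then w' else l :: w else [:: l].

Lemma linvK : involutive linv.
Proof. by case=> x b; rewrite /linv /= negbK. Qed.

Lemma linv_neq l : linv l != l.
Proof. by case: l => x b; rewrite /linv xpair_eqE /= eqxx; case: b. Qed.

Lemma reduced_push l w : reduced w -> reduced (push l w).
Proof.
case: w => [|m w] //= red_mw; case: eqP => [_|/eqP neq_ml].
  exact: path_sorted red_mw.
by rewrite /reduced /= neq_ml.
Qed.

Lemma reduced_foldr u w : reduced w -> reduced (foldr push w u).
Proof. by move=> ?; elim: u => //= l u; exact: reduced_push. Qed.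

Lemma pushK l w : reduced w -> push l (push (linv l) w) = w.
Proof.
case: w => [|m w] /=; first by rewrite eqxx.
rewrite linvK; case: eqP => [->|_ _] /=; last by rewrite eqxx.
by case: w => [|n w] //= /andP[/negPf ->].
Qed.

Lemma foldr_push_cons l v w : reduced w ->
  foldr push w (push l v) = push l (foldr push w v).
Proof.
case: v => [|m v] //= red_w; case: eqP => [->|//].
by rewrite pushK // reduced_foldr.
Qed.

Lemma foldr_push_id w : reduced w -> foldr push [::] w = w.
Proof.
elim: w => //= l w IHw red_lw.
have -> := IHw (path_sorted red_lw).
by case: w red_lw {IHw} => //= m w /andP[/negPf ->].
Qed.

Lemma reduced_rev_linv w : reduced w -> reduced (rev (map linv w)).
Proof.
rewrite /reduced rev_sorted sorted_map; apply: sub_sorted => l m /=.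
by rewrite linvK eq_sym.
Qed.

Lemma foldr_rev_linv w v : foldr push (w ++ v) (rev (map linv w)) = v.
Proof.
elim: w v => //= l w IHw v.
by rewrite rev_cons foldr_rcons /= linvK eqxx IHw.
Qed.

Definition fg1 : freegroup := @FreeGroup [::] isT.
Definition fgM (u v : freegroup) : freegroup :=
  FreeGroup (reduced_foldr (fgword u) (fgwordP v)).
Definition fgV (u : freegroup) : freegroup :=
  FreeGroup (reduced_rev_linv (fgwordP u)).

Lemma fgMA : associative fgM.
Proof.
move=> u v w; apply: val_inj => /=.
elim: (fgword u) => //= l u' ->.
by rewrite foldr_push_cons ?fgwordP.
Qed.

Lemma fg1M : left_id fg1 fgM. Proof. by move=> u; exact: val_inj. Qed.

Lemma fgM1 : right_id fg1 fgM.
Proof. by move=> u; apply: val_inj; exact: foldr_push_id (fgwordP u). Qed.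

Lemma fgMV : left_inverse fg1 fgV fgM.
Proof.
by move=> u; apply: val_inj => /=; rewrite -{1}[fgword u]cats0 foldr_rev_linv.
Qed.

Lemma fgVK : involutive fgV.
Proof.
move=> u; apply: val_inj => /=.
by rewrite map_rev revK -map_comp (eq_map (g := id)) ?map_id //; exact: linvK.
Qed.

Lemma fgVM : right_inverse fg1 fgV fgM.
Proof. by move=> u; rewrite -{1}[u]fgVK fgMV. Qed.

HB.instance Definition _ := isGroup.Build freegroup fgMA fg1M fgM1 fgMV fgVM.

End FreeGroup.

(** * Finite separated graphs *)

Record sepgraph := SepGraph {
  vert : finType;
  edge : finType;
  src : edge -> vert;
  rng : edge -> vert;
  sep : vert -> {set {set edge}};
  (* [partition] includes that the blocks are nonempty *)
  sepP : forall v, finset.partition (sep v) [set x | rng x == v]%SET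
}.

Definition bipartite (G : sepgraph) (E00 E01 : {set vert G}) : Prop :=
  [/\ (E00 :|: E01 = [set: vert G])%SET, (E00 :&: E01 = finset.set0)%SET,
      (forall x : edge G, src x \in E01 /\ rng x \in E00),
      (@rng G @: [set: edge G] = E00)%SET & (@src G @: [set: edge G] = E01)%SET].

Section ConditionL.
Variable G : sepgraph.

(* the element $X_x$ of $C$ that contains [x] *)
Definition block (x : edge G) : {set edge G} := finset.pblock (sep (rng x)) x.

(* A function [e] stands for the path of length [n] in the double graph which,
   written right to left, is $\cdots e_3 e_2^* e_1$; it is indexed from 1 and
   only the values [e 1], ..., [e n] matter. Its edges compose when
   $r(e_{2i-1}) = r(e_{2i})$ (the source of $e_{2i}^*$) and
   $s(e_{2i}) = s(e_{2i+1})$ (the first being the range of $e_{2i}^*$). *)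
Definition dpath (n : nat) (e : nat -> edge G) : Prop :=
  (forall i, (1 <= i)%N -> (2 * i <= n)%N ->
     rng (e (2 * i - 1)%N) = rng (e (2 * i)%N)) /\
  (forall i, (1 <= i)%N -> (2 * i + 1 <= n)%N ->
     src (e (2 * i)%N) = src (e (2 * i + 1)%N)).

Definition admissible (n : nat) (e : nat -> edge G) : Prop :=
  [/\ dpath n e,
      forall i, (1 <= i)%N -> (2 * i <= n)%N ->
        block (e (2 * i - 1)%N) <> block (e (2 * i)%N)
    & forall i, (1 <= i)%N -> (2 * i + 1 <= n)%N ->
        e (2 * i + 1)%N <> e (2 * i)%N].

(* the path $e_{2r}^* e_{2r-1} \cdots e_2^* e_1$ *)
Definition closed_path (r : nat) (e : nat -> edge G) : Prop :=
  [/\ (1 <= r)%N, admissible (2 * r) e & src (e 1%N) = src (e (2 * r)%N)].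

Definition cycle_path (r : nat) (e : nat -> edge G) : Prop :=
  [/\ closed_path r e, e 1%N <> e (2 * r)%N
    & forall i j, (1 <= i)%N -> (i <= j)%N -> (j < r)%N ->
        src (e (2 * i - 1)%N) <> src (e (2 * j)%N)].

(* the path $x_{2t-1} x_{2t-2}^* \cdots x_2^* x_1$ is an entry of [e] *)
Definition entry (e : nat -> edge G) (t : nat) (x : nat -> edge G) : Prop :=
  [/\ (1 <= t)%N, admissible (2 * t - 1) x, src (x 1%N) = src (e 1%N)
    & exists2 X, X \in sep (rng (x (2 * t - 1)%N))
                 & X <> block (x (2 * t - 1)%N) /\ (2 <= #|X|)%N].

Definition conditionL : Prop :=
  forall r e, cycle_path r e -> exists t x, entry e t x.

End ConditionL.

(** * Dynamical systems *)

Definition set_homeo (T : topologicalType) (A B : set T) (f g : T -> T) : Prop :=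
  [/\ set_fun A B f, set_fun B A g, {in A, cancel f g} & {in B, cancel g f}] /\
  ({within A, continuous f} /\ {within B, continuous g}).

(* $\theta_x$ and its inverse are given by total functions, whose values outside
   $\Omega_{s(x)}$ and $H_x$, respectively, are irrelevant. *)
Record dynsys (G : sepgraph) (T : topologicalType) := DynSys {
  Om : vert G -> set T;
  Hx : edge G -> set T;
  th : edge G -> T -> T;
  thV : edge G -> T -> T;
  ds_compact : compact [set: T];
  ds_hausdorff : hausdorff_space T;
  ds_Om_clopen : forall v, clopen (Om v);
  ds_Om_disjoint : trivIset [set: vert G] Om;
  ds_Om_cover : \bigcup_v Om v = [set: T];
  ds_Hx_clopen : forall x, clopen (Hx x);
  ds_Hx_sub : forall x, Hx x `<=` Om (rng x);
  ds_Hx_disjoint : forall v (X : {set edge G}), X \in sep v ->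
    trivIset [set x | x \in X] Hx;
  ds_Hx_cover : forall v (X : {set edge G}), X \in sep v ->
    \bigcup_(x in [set x | x \in X]) Hx x = Om v;
  ds_homeo : forall x, set_homeo (Om (src x)) (Hx x) (th x) (thV x)
}.

Definition equivariant (G : sepgraph) (T T' : topologicalType)
    (S : dynsys G T) (S' : dynsys G T') (f : T -> T') : Prop :=
  [/\ forall w, f @` Om S w `<=` Om S' w,
      forall x, f @` Hx S x `<=` Hx S' x
    & forall x p, Om S (src x) p -> f (th S x p) = th S' x (f p)].

Definition universal (G : sepgraph) (T : topologicalType) (S : dynsys G T) : Prop :=
  forall (T' : topologicalType) (S' : dynsys G T'),
    exists! f : T' -> T, continuous f /\ equivariant S' S f.

(** * The partial action of the free group, and its crossed product *)

Section CrossedProduct.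
Variables (G : sepgraph) (T : topologicalType) (S : dynsys G T) (K : fieldType).

Local Notation F := (freegroup (edge G)).

(* partial maps, [None] meaning undefined *)
Definition theta1 (l : edge G * bool) (p : T) : option T :=
  if l.2 then (if p \in Hx S l.1 then Some (thV S l.1 p) else None)
  else (if p \in Om S (src l.1) then Some (th S l.1 p) else None).

Definition theta (g : F) (p : T) : option T :=
  foldr (fun l q => obind (theta1 l) q) (Some p) (fgword g).

(* $U_g$ is the domain of $\theta_{g^{-1}}$. *)
Definition Ug (g : F) : set T := [set p | theta g^-1%g p].

Definition CK : set (T -> K) :=
  [set f | continuous (f : T -> discrete_topology K)].

Definition eg (g : F) : T -> K := \1_(Ug g).

Definition Dg (g : F) : set (T -> K) := [set eg g * f | f in CK].

Definition alpha (g : F) (f : T -> K) : T -> K :=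
  fun p => if theta g^-1%g p is Some q then f q else 0.

(* The formal sum $\sum_g a_g \delta_g$ is the function [g |-> a g]. *)
Definition crossed : set (F -> T -> K) :=
  [set a | finite_set [set g | a g <> 0] /\ forall g, Dg g (a g)].

(* [f \delta_g] *)
Definition delta (f : T -> K) (g : F) : F -> T -> K :=
  fun h => if h == g then f else 0.

(* The bilinear extension of
   $(a_g\delta_g)(b_h\delta_h) = \alpha_g(\alpha_{g^{-1}}(a_g)b_h)\delta_{gh}$:
   the coefficient of $\delta_k$ collects all [g], [h] with [g * h = k], and the
   sum is finite on [crossed]. This is not the pointwise product of functions. *)
Definition crossM (a b : F -> T -> K) : F -> T -> K :=
  fun k => \sum_(g \in [set: F])
    alpha g (alpha g^-1%g (a g) * b (g^-1 * k)%g).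

(* two-sided ideals; these are automatically subspaces, as the crossed product
   has the unit [delta 1 1] *)
Definition ideal (I : set (F -> T -> K)) : Prop :=
  [/\ I `<=` crossed, I 0, forall a b, I a -> I b -> I (a + b)
    & forall a x, I a -> crossed x -> I (crossM x a) /\ I (crossM a x)].

Definition projection (conjK : K -> K) (h : T -> K) : Prop :=
  [/\ CK h, h * h = h & conjK \o h = h].

End CrossedProduct.

(* Main.v *)
Require Import Defs.
From mathcomp Require Import all_boot all_order all_algebra.
From mathcomp Require Import all_classical.
From mathcomp Require Import topology numfun zify.

Set Implicit Arguments.
Unset Strict Implicit.
Unset Printing Implicit Defensive.

Import GRing.Theory.
Local Open Scope classical_set_scope.

(** The theorem comes down to topological freeness: for g <> 1, the fixed points
    of $\theta_g$ have empty interior ([topologically_free]). Granting this, pick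
    g with [a g <> 0] and multiply [a] on the right by $e(g^{-1})\delta_{g^{-1}}$,
    which moves [a g] to the coefficient of 1. On some nonempty clopen V inside
    $U_g$ that coefficient is a constant lambda <> 0. Only finitely many other
    coefficients are nonzero, so V contains a nonempty clopen W that is disjoint
    from its translates by the corresponding group elements
    ([wandering_clopen]). Compressing by $h = 1_W$ kills these coefficients and
    leaves $\lambda h$.

    To study the universal system it is compared with an explicit one. A
    configuration labels each element of the free group F with nothing, or with
    a vertex and a set of edges that determines one edge in each block of the
    partition at the vertex; the labels must match along the edges of the Cayley
    graph. These form a compact space on which F acts partially by translation
    ([config_sys]). Following the partial action, each point has an itinerary,
    which is a configuration, and the universal property makes the itinerary map
    a section of an equivariant map from configurations to the universal system
    ([itinerary_retract]). Hence points are separated by their itineraries, and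
    each configuration can be pushed into the universal system without changing
    which group elements act on it.

    Suppose now that $\theta_g$ is the identity on a nonempty clopen V, with g <> 1
    as short as possible. Conjugating by a letter would shorten g if g were not
    cyclically reduced, so g is cyclically reduced, and rotating its word
    preserves all this. Bipartiteness makes the word of g a closed path in
    $(E,C)$, when it is read from a point over $E^{0,1}$. From some vertex of this
    path, an admissible path leads to a block with at least two elements that is
    not the block of its last edge: condition (L) only concerns cycles, but a
    shortest repetition of vertices in the closed path either gives a cycle or
    already contains such a block ([closed_path_branching]). After a rotation,
    the vertex is that of the base point p. Let z0 be the word of the path to
    the block and x the edge that the itinerary of p selects there. For g or its
    inverse, the powers of g followed by z0 x are reduced, so $g^n z_0$ lies
    arbitrarily far from 1 for large n. Change the itinerary of p at $g^n z_0$
    only, so that it selects another edge y of the block, and regrow everything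
    beyond. The result is close to the itinerary of p, so its image lies in V and
    is fixed by g. It is defined at $z_0 x$, hence by invariance at $g^n z_0 x$; but
    there it was cut off ([no_fixed_branching]). *)

(** * Words in the free group *)

Section Words.
Variable A : choiceType.
Local Notation letter := (A * bool)%type.
Implicit Types (g h : freegroup A) (l : letter) (w : seq letter).

(** The group element of a word that need not be reduced. *)
Definition fgof w : freegroup A :=
  @FreeGroup A (foldr (@push A) [::] w) (@reduced_foldr A w [::] isT).

Lemma fgwordK g : fgof (fgword g) = g.
Proof. by apply: val_inj => /=; rewrite foldr_push_id ?fgwordP. Qed.

Lemma fgwordE w : reduced w -> fgword (fgof w) = w.
Proof. exact: foldr_push_id. Qed.

Lemma fgof_cons l w : fgof (l :: w) = (fgof [:: l] * fgof w)%g.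
Proof. exact: val_inj. Qed.

Lemma fgof_cat w1 w2 : fgof (w1 ++ w2) = (fgof w1 * fgof w2)%g.
Proof.
elim: w1 => [|l w1 IH] /=; first by rewrite (_ : fgof [::] = 1%g) ?mul1g //; exact: val_inj.
by rewrite fgof_cons IH mulgA -fgof_cons.
Qed.

Lemma fgof_linv l : fgof [:: linv l] = (fgof [:: l])^-1%g.
Proof. exact: val_inj. Qed.

Lemma fgof_rev_linv w : fgof (rev (map (@linv A) w)) = (fgof w)^-1%g.
Proof.
elim: w => [|l w IH] /=; first exact: val_inj.
by rewrite rev_cons -cats1 fgof_cat IH fgof_linv -invgM -fgof_cons.
Qed.

Lemma fgwordV g : fgword g^-1%g = rev (map (@linv A) (fgword g)).
Proof. by []. Qed.

Lemma size_fgof w : (size (fgword (fgof w)) <= size w)%N.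
Proof.
elim: w => //= l w IH.
by rewrite /push; case: foldr IH => [|m u] //= IH; case: ifP => _ /=; lia.
Qed.

Lemma reduced_cat w1 w2 l : reduced w1 -> reduced w2 -> w1 != [::] -> w2 != [::] ->
  head l w2 != linv (last l w1) -> reduced (w1 ++ w2).
Proof.
case: w1 => [//|a w1]; case: w2 => [//|b w2] r1 r2 _ _ /= h.
by move: r1 r2; rewrite /reduced /= cat_path /= => -> ->; rewrite h.
Qed.

Lemma reduced_rcons w l m : reduced (rcons w l) -> m != linv l -> reduced (rcons (rcons w l) m).
Proof.
move=> rd ml; rewrite -[rcons (rcons w l) m]cats1; apply: (@reduced_cat _ _ l) => //.
  by case: (w).
by rewrite last_rcons.
Qed.

Lemma reduced_rev_cons w l : reduced (rev (l :: w)) -> reduced (rev w).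
Proof. by rewrite rev_cons -cats1 => /cat_sorted2[]. Qed.

Lemma reduced_rev_cons2 w l m :
  reduced (rev (m :: w)) -> l != linv m -> reduced (rev [:: l, m & w]).
Proof. by rewrite !rev_cons; exact: reduced_rcons. Qed.

End Words.

(** * Closed paths and branching vertices *)

Section Branching.
Variable G : sepgraph.
Implicit Types (x y : edge G) (v : vert G) (X : {set edge G}).

Lemma sep_disjoint v X Y z : X \in sep v -> Y \in sep v -> z \in X -> z \in Y -> X = Y.
Proof.
case/and3P: (sepP v) => _ tI _ sX sY zX zY.
by rewrite -(finset.def_pblock tI sX zX) (finset.def_pblock tI sY zY).
Qed.

Lemma sep_rng v X x : X \in sep v -> x \in X -> rng x = v.
Proof.
case/and3P: (sepP v) => /eqP cov _ _ sX xX.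
have : x \in finset.cover (sep v) by apply/finset.bigcupP; exists X.
by rewrite cov finset.inE => /eqP.
Qed.

Lemma sep_neq0 v X : X \in sep v -> X != finset.set0.
Proof. by case/and3P: (sepP v) => _ _ n0 sX; apply: contraNneq n0 => <-. Qed.

Lemma block_sep x : block x \in sep (rng x).
Proof.
case/and3P: (sepP (rng x)) => /eqP cov _ _; rewrite /block.
by apply: finset.pblock_mem; rewrite cov finset.inE.
Qed.

Lemma mem_block x : x \in block x.
Proof.
case/and3P: (sepP (rng x)) => /eqP cov _ _; rewrite /block.
by rewrite finset.mem_pblock cov finset.inE.
Qed.

Lemma sep_block v X x : X \in sep v -> x \in X -> block x = X.
Proof.
move=> sX xX; have rx := sep_rng sX xX; apply: (@sep_disjoint v _ _ x) => //.
  by rewrite -rx block_sep.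
exact: mem_block.
Qed.

(** An entry, as in condition (L), depends on the closed path only through its
    first vertex; this is the existence of an entry, stated for the vertex. *)
Definition branching v : Prop :=
  exists t (x : nat -> edge G), [/\ (1 <= t)%N, admissible (2 * t - 1) x, src (x 1%N) = v
    & exists2 X, X \in sep (rng (x (2 * t - 1)%N))
                 & X <> block (x (2 * t - 1)%N) /\ (2 <= #|X|)%N].

Hypothesis hL : conditionL G.

Lemma cycle_branching r e : Defs.cycle_path r e -> branching (src (e 1%N)).
Proof. by case/hL => t [x [? ? ? ?]]; exists t, x. Qed.

(** Take indices i <= j = i + d with s(e_{2i-1}) = s(e_{2j}) and d minimal. If
    e_{2i-1} <> e_{2j}, the piece between them is a cycle and condition (L) applies.
    Otherwise this piece is a lollipop, whose stick e_{2i-1} = e_{2j} is removed: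
    the rest, turned so that e_{2i}^* comes last, is a cycle when e_{2j-1} and
    e_{2i} lie in different blocks. When they lie in the same block, either they
    differ and this block is itself an entry after e_{2i-1}, or they are equal,
    which admissibility excludes for d = 1, and otherwise i + 1 and j - 1
    contradict minimality. *)
Lemma closed_path_branching r (e : nat -> edge G) : closed_path r e ->
  exists i, [/\ (1 <= i)%N, (i <= r)%N & branching (src (e (2 * i - 1)%N))].
Proof.
case=> r1 [[eR eS] eB eE] eC.
suff H d i : (1 <= i)%N -> (i + d <= r)%N ->
    src (e (2 * i - 1)%N) = src (e (2 * (i + d))%N) ->
    exists i, [/\ (1 <= i)%N, (i <= r)%N & branching (src (e (2 * i - 1)%N))].
  apply: (@H (r - 1)%N 1%N) => //; first lia.
  by rewrite (_ : (1 + (r - 1) = r)%N) //; lia.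
elim/ltn_ind: d i => d IH i i1 ir se.
have [[d' [i' [dd i'1 i'r se']]]|min] := pselect (exists d' i', [/\ (d' < d)%N, (1 <= i')%N, (i' + d' <= r)%N &
    src (e (2 * i' - 1)%N) = src (e (2 * (i' + d'))%N)]); first exact: (IH d' dd i').
have {}min i' j' : (1 <= i')%N -> (i' <= j')%N -> (j' < i' + d)%N -> (j' <= r)%N ->
    src (e (2 * i' - 1)%N) <> src (e (2 * j')%N).
  move=> h1 h2 h3 h4 h; apply: min; exists (j' - i')%N, i'; split=> //; try lia.
  by rewrite subnKC.
have [ee|ee] := pselect (e (2 * i - 1)%N = e (2 * (i + d))%N); last first.
  (* the piece e_{2i-1}, ..., e_{2j} is a cycle *)
  exists i; split=> //; first lia.
  pose e' k := e (2 * i - 2 + k)%N.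
  have -> : src (e (2 * i - 1)%N) = src (e' 1%N) by congr (src (e _)); lia.
  apply: (@cycle_branching d.+1); split.
  - split=> //.
      split.
      + split=> k k1 k2; rewrite /e'.
          have := eR (i - 1 + k)%N ltac:(lia) ltac:(lia).
          by congr (rng (e _) = rng (e _)); lia.
        have := eS (i - 1 + k)%N ltac:(lia) ltac:(lia).
        by congr (src (e _) = src (e _)); lia.
      + move=> k k1 k2; have := eB (i - 1 + k)%N ltac:(lia) ltac:(lia).
        by rewrite /e'; congr (block (e _) <> block (e _)); lia.
      + move=> k k1 k2; have := eE (i - 1 + k)%N ltac:(lia) ltac:(lia).
        by rewrite /e'; congr (e _ <> e _); lia.
    by move: se; rewrite /e'; congr (src (e _) = src (e _)); lia.
  - by move: ee; rewrite /e'; congr (e _ <> e _); lia.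
  - move=> a b a1 ab bd; have := min (i - 1 + a)%N (i - 1 + b)%N ltac:(lia) ltac:(lia) ltac:(lia) ltac:(lia).
    by rewrite /e'; congr (src (e _) <> src (e _)); lia.
have d1 : (1 <= d)%N.
  rewrite lt0n; apply/eqP => d0; apply: (eB i i1 ltac:(lia)).
  by rewrite ee d0 addn0.
have [bb|bb] := pselect (block (e (2 * (i + d) - 1)%N) = block (e (2 * i)%N)).
  have [ff|ff] := pselect (e (2 * (i + d) - 1)%N = e (2 * i)%N); last first.
    exists i; split=> //; first lia.
    exists 1%N, (fun=> e (2 * i - 1)%N); split=> //.
      by split; [split|..]; move=> k; lia.
    exists (block (e (2 * i)%N)); first by rewrite (eR i) ?block_sep //; lia.
    split; first by move=> h; apply: (eB i) => //; lia.
    have : ([set e (2 * (i + d) - 1)%N; e (2 * i)%N] \subset block (e (2 * i)%N))%SET.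
      by rewrite finset.subUset !finset.sub1set mem_block -bb mem_block.
    by move/subset_leq_card; rewrite finset.cards2; case: eqP.
  have d2 : (2 <= d)%N.
    rewrite ltn_neqAle d1 andbT; apply/eqP => dd.
    apply: (eE i) => //; first lia.
    by rewrite -ff; congr e; lia.
  apply: False_ind; apply: (@min i.+1 (i + d - 1)%N); try lia.
  have := eS i i1 ltac:(lia); rewrite -ff => h.
  have := eS (i + d - 1)%N ltac:(lia) ltac:(lia).
  have -> : (2 * (i + d - 1) + 1 = 2 * (i + d) - 1)%N by lia.
  by rewrite h => ->; congr (src (e _)); lia.
(* the cycle e_{2i}^* e_{2j-1} ... e_{2i+1} left once the stick is removed *)
exists i.+1; split; [lia|lia|].
pose e' k := if k == (2 * d)%N then e (2 * i)%N else e (2 * i + k)%N.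
have e'E k : (k < 2 * d)%N -> e' k = e (2 * i + k)%N.
  by rewrite /e'; case: eqP => //; lia.
have e'd : e' (2 * d)%N = e (2 * i)%N by rewrite /e' eqxx.
have -> : src (e (2 * i.+1 - 1)%N) = src (e' 1%N) by rewrite e'E; [congr (src (e _)) | ]; lia.
apply: (@cycle_branching d); split.
- split=> //.
    split.
    + split=> k k1 k2; last first.
        rewrite !e'E; try lia.
        have := eS (i + k)%N ltac:(lia) ltac:(lia).
        by congr (src (e _) = src (e _)); lia.
      have [kd|kd] := eqVneq k d.
        rewrite kd e'd e'E; last lia.
        have := eR (i + d)%N ltac:(lia) ltac:(lia); rewrite -ee (eR i i1); last lia.
        by move=> <-; congr (rng (e _)); lia.
      rewrite !e'E; try (move/eqP: kd; lia).
      have := eR (i + k)%N ltac:(lia) ltac:(lia).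
      by congr (rng (e _) = rng (e _)); lia.
    + move=> k k1 k2; have [kd|kd] := eqVneq k d.
        rewrite kd e'd e'E; last lia.
        by move: bb; congr (block (e _) <> _); lia.
      rewrite !e'E; try (move/eqP: kd; lia).
      have := eB (i + k)%N ltac:(lia) ltac:(lia).
      by congr (block (e _) <> block (e _)); lia.
    + move=> k k1 k2; rewrite !e'E; try lia.
      have := eE (i + k)%N ltac:(lia) ltac:(lia).
      by congr (e _ <> e _); lia.
  by rewrite e'd e'E; [rewrite -eS //|]; lia.
- by rewrite e'd e'E; [apply: eE|]; lia.
- move=> a b a1 ab bd; rewrite !e'E; try lia.
  have := min (i + a)%N (i + b)%N ltac:(lia) ltac:(lia) ltac:(lia) ltac:(lia).
  by congr (src (e _) <> src (e _)); lia.
Qed.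

End Branching.

(** * The partial action along words *)

Section PartialAction.
Variables (G : sepgraph) (T : topologicalType) (S : dynsys G T).
Local Notation F := (freegroup (edge G)).
Local Notation letter := (edge G * bool)%type.
Implicit Types (x y : edge G) (v : vert G) (p q : T) (l : letter) (w : seq letter) (g h u : F).

Lemma Om_ex p : exists v, Om S v p.
Proof. by have : [set: T] p by []; rewrite -(ds_Om_cover S) => -[v _]; exists v. Qed.

Lemma Om_inj v v' p : Om S v p -> Om S v' p -> v = v'.
Proof. by move=> h h'; apply: (ds_Om_disjoint (d := S)) => //; exists p. Qed.

Lemma Hx_ex v X p : X \in sep v -> Om S v p -> exists2 x, x \in X & Hx S x p.
Proof. by move=> sX; rewrite -(ds_Hx_cover S sX) => -[x xX hx]; exists x. Qed.

Lemma Hx_inj v X x y p : X \in sep v -> x \in X -> y \in X -> Hx S x p -> Hx S y p -> x = y.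
Proof. by move=> sX xX yX h h'; apply: (ds_Hx_disjoint (d := S) sX) => //; exists p. Qed.

Lemma Hx_Om x p : Hx S x p -> Om S (rng x) p.
Proof. exact: ds_Hx_sub. Qed.

Lemma theta1_pos x p : Om S (src x) p -> theta1 S (x, false) p = Some (th S x p).
Proof. by move=> /mem_set; rewrite /theta1 /= => ->. Qed.

Lemma theta1_neg x p : Hx S x p -> theta1 S (x, true) p = Some (thV S x p).
Proof. by move=> /mem_set; rewrite /theta1 /= => ->. Qed.

Lemma theta1_posN x p : ~ Om S (src x) p -> theta1 S (x, false) p = None.
Proof. by move=> h; rewrite /theta1 /= memNset. Qed.

Lemma theta1_negN x p : ~ Hx S x p -> theta1 S (x, true) p = None.
Proof. by move=> h; rewrite /theta1 /= memNset. Qed.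

Lemma theta1_posP x p q : theta1 S (x, false) p = Some q -> Om S (src x) p /\ Hx S x q.
Proof.
rewrite /theta1 /=; case: ifP => //; rewrite inE => op [<-]; split=> //.
by case: (ds_homeo S x) => -[f _ _ _] _; exact: f.
Qed.

Lemma theta1_negP x p q : theta1 S (x, true) p = Some q -> Hx S x p /\ Om S (src x) q.
Proof.
rewrite /theta1 /=; case: ifP => //; rewrite inE => op [<-]; split=> //.
by case: (ds_homeo S x) => -[_ f _ _] _; exact: f.
Qed.

(** The inverse letter undoes a step; all group laws of the partial action come
    from this. *)
Lemma theta1_inv l p q : theta1 S l p = Some q -> theta1 S (linv l) q = Some p.
Proof.
case: l => x []; rewrite /theta1 /=; case: ifP => // hp [<-].
  case: (ds_homeo S x) => -[_ f _ fK] _; move: (hp); rewrite inE => /f /mem_set ->.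
  by rewrite fK.
case: (ds_homeo S x) => -[f _ fK _] _; move: (hp); rewrite inE => /f /mem_set ->.
by rewrite fK.
Qed.

(** The action of a word that need not be reduced. Its domain may be smaller than
    that of the reduced word, since both steps of a cancelling pair must be
    defined. *)
Definition wtheta w p : option T := foldr (fun l o => obind (theta1 S l) o) (Some p) w.

Lemma thetaE g p : theta S g p = wtheta (fgword g) p. Proof. by []. Qed.

Lemma wtheta_cat w1 w2 p : wtheta (w1 ++ w2) p = obind (wtheta w1) (wtheta w2 p).
Proof.
rewrite /wtheta foldr_cat; case: (foldr _ _ w2) => //=.
by elim: w1 => //= l w1 ->.
Qed.

(** Cancelling inverse letters can only enlarge the domain of a composition. *)
Lemma wtheta_fgof w p q : wtheta w p = Some q -> theta S (fgof w) p = Some q.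
Proof.
elim: w q => // l w IH q /=; case E: (wtheta w p) => [r|] //= lr.
have := IH _ E; rewrite !thetaE /= /push; case: (foldr _ _ w) => [|m u] /=; first by case=> ->.
case: eqP => [->|_] /=; last by move=> ->.
rewrite -/(wtheta u p); case E2: (wtheta u p) => [s|] //= /theta1_inv.
by rewrite linvK lr => ->.
Qed.

Lemma wtheta_inv w p q : wtheta w p = Some q -> wtheta (rev (map (@linv _) w)) q = Some p.
Proof.
elim: w q => [|l w IH] q /=; first by case=> ->.
case E: (wtheta w p) => [r|] //= /theta1_inv lr.
by rewrite rev_cons -cats1 wtheta_cat /= lr /= IH.
Qed.

Lemma theta_inv g p q : theta S g p = Some q -> theta S g^-1%g q = Some p.
Proof. exact: wtheta_inv. Qed.

Lemma theta_id p : theta S 1%g p = Some p. Proof. by []. Qed.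

Lemma theta_mul h u p q r : theta S h p = Some q -> theta S u q = Some r -> theta S (u * h)%g p = Some r.
Proof.
move=> hp uq; rewrite -[u]fgwordK -[h]fgwordK -fgof_cat; apply: wtheta_fgof.
by rewrite wtheta_cat -thetaE hp /= -thetaE.
Qed.

Lemma theta_comp h u p q : theta S h p = Some q -> theta S u q = theta S (u * h)%g p.
Proof.
move=> hp; case E: (theta S u q) => [r|]; first by rewrite (theta_mul hp E).
case E2: (theta S _ p) => [r|] //.
by have := theta_mul (theta_inv hp) E2; rewrite mulgK E.
Qed.

(** Reading a word w from left to right computes $\theta_{w^{-1}}$; so p lies in $U_w$
    exactly when the walk along w is defined at p. In this order the words that
    can be read at p are closed under prefixes. *)
Definition walk w p : option T := foldl (fun o l => obind (theta1 S (linv l)) o) (Some p) w.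

Lemma walkE w p : walk w p = wtheta (rev (map (@linv _) w)) p.
Proof.
by rewrite /walk /wtheta -foldl_rev revK; elim: w (Some p) => //= l w IH o; exact: IH.
Qed.

Lemma thetaV_walk g p : theta S g^-1%g p = walk (fgword g) p.
Proof. by rewrite walkE. Qed.

Lemma walk_cat w1 w2 p : walk (w1 ++ w2) p = obind (walk w2) (walk w1 p).
Proof. by rewrite !walkE map_cat rev_cat wtheta_cat; case: wtheta => //= q; rewrite walkE. Qed.

Lemma walk_rcons w l p : walk (rcons w l) p = obind (theta1 S (linv l)) (walk w p).
Proof. by rewrite -cats1 walk_cat; case: walk. Qed.

Lemma walk_fgof w p q : walk w p = Some q -> theta S (fgof w)^-1%g p = Some q.
Proof. by rewrite walkE -fgof_rev_linv; exact: wtheta_fgof. Qed.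

End PartialAction.

(** * Equivariant maps *)

Section Equivariance.
Variables (G : sepgraph) (T T' : topologicalType) (S : dynsys G T) (S' : dynsys G T').
Variable f : T -> T'.
Hypothesis eqf : equivariant S S' f.

(** Equivariance only asks for one direction; the other holds because the
    $\Omega_v$ cover one space and are disjoint in the other. *)
Lemma equivariant_Om v p : Om S' v (f p) <-> Om S v p.
Proof.
case: eqf => fO _ _; split; last by move=> h; apply: fO; exists p.
move=> h; have [w hw] := Om_ex S p.
have h' : Om S' w (f p) by apply: fO; exists p.
by rewrite (Om_inj h h').
Qed.

Lemma equivariant_Hx x p : Hx S' x (f p) <-> Hx S x p.
Proof.
case: eqf => fO fH _; split; last by move=> h; apply: fH; exists p.
move=> h; have /equivariant_Om op := Hx_Om h.
have [y yX hy] := Hx_ex (block_sep x) op.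
have h' : Hx S' y (f p) by apply: fH; exists p.
by rewrite (Hx_inj (block_sep x) (mem_block x) yX h h').
Qed.

Lemma equivariant_theta1 l p : theta1 S' l (f p) = omap f (theta1 S l p).
Proof.
have pos x q : Om S (src x) q -> f (th S x q) = th S' x (f q) by case: eqf => _ _; exact.
case: l => x [].
- have [h|h] := pselect (Hx S x p); last first.
    by rewrite !theta1_negN // => /equivariant_Hx.
  have E := theta1_neg h; rewrite E /=; apply: (@theta1_inv _ _ S' (x, false)).
  move: (theta1_inv E) (theta1_negP E) => /= E' [_ op].
  rewrite theta1_pos; last exact/equivariant_Om.
  by rewrite -pos //; move: E'; rewrite /linv /= theta1_pos // => -[->].
- have [h|h] := pselect (Om S (src x) p); last first.
    by rewrite !theta1_posN // => /equivariant_Om.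
  by rewrite !theta1_pos //= ?pos //; exact/equivariant_Om.
Qed.

Lemma equivariant_theta g p : theta S' g (f p) = omap f (theta S g p).
Proof.
rewrite !thetaE; elim: (fgword g) => //= l w ->.
by rewrite -/(wtheta S w p); case: (wtheta S w p) => //= q; exact: equivariant_theta1.
Qed.

End Equivariance.

Lemma equivariant_comp (G : sepgraph) (T1 T2 T3 : topologicalType) (S1 : dynsys G T1)
    (S2 : dynsys G T2) (S3 : dynsys G T3) (f : T1 -> T2) (g : T2 -> T3) :
  equivariant S1 S2 f -> equivariant S2 S3 g -> equivariant S1 S3 (g \o f).
Proof.
move=> ef eg; split.
- by move=> w _ [p h <-] /=; apply/(equivariant_Om eg)/(equivariant_Om ef).
- by move=> x _ [p h <-] /=; apply/(equivariant_Hx eg)/(equivariant_Hx ef).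
- move=> x p h /=; case: ef (equivariant_Om ef (src x) p) => _ _ -> // [_ /(_ h) h'].
  by case: eg => _ _ ->.
Qed.

Lemma equivariant_id (G : sepgraph) (T : topologicalType) (S : dynsys G T) :
  equivariant S S id.
Proof. by split=> //; move=> ?; rewrite image_id. Qed.

(** * Locally constant functions and the partial action *)

Section LocallyConstant.
Variable T : topologicalType.

Definition locconst (Z : Type) (f : T -> Z) : Prop :=
  forall p, \forall q \near p, f q = f p.

Lemma locconst_open (Z : Type) (f : T -> Z) (P : set Z) : locconst f -> open (f @^-1` P).
Proof. by move=> lf; rewrite openE => p Pp; apply: filterS (lf p) => q; rewrite /= => ->. Qed.

Lemma locconst_clopen (Z : Type) (f : T -> Z) (P : set Z) : locconst f -> clopen (f @^-1` P).
Proof. by move=> lf; split; [|rewrite -[_ @^-1` _]setCK preimage_setC closedC]; exact: locconst_open. Qed.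

Lemma clopen_locconst (P : set T) : clopen P -> locconst (fun p => p \in P).
Proof.
move=> [oP cP] p; have [h|h] := pselect (P p).
  rewrite mem_set //; apply: filterS (open_nbhs_nbhs (conj oP h)) => q.
  exact: mem_set.
rewrite memNset //; move: cP; rewrite -openC => cP.
by apply: filterS (open_nbhs_nbhs (conj cP h)) => q; exact: memNset.
Qed.

Lemma locconst_continuous (K : choiceType) (f : T -> K) :
  locconst f <-> continuous (f : T -> discrete_topology K).
Proof.
split=> h p; first by apply/discrete_cvg; exact: h.
by have /discrete_cvg := h p; exact.
Qed.

Variables (G : sepgraph) (S : dynsys G T).

(** Both domains are clopen, so whether a step is defined is locally constant, and
    where it is defined it is continuous. *)
Lemma locconst_theta1 l (Z : Type) (f : T -> Z) :
  locconst f -> locconst (fun p => omap f (theta1 S l p)).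
Proof.
have H (D : set T) (h : T -> T) : clopen D -> {within D, continuous h} -> locconst f ->
    locconst (fun p => omap f (if p \in D then Some (h p) else None)).
  move=> cD; rewrite continuous_open_subspace; last exact: cD.1.
  move=> ch lf p; have := clopen_locconst cD p.
  have [hp|hp] := boolP (p \in D); last by apply: filterS => q ->.
  move=> nD; have := ch p hp _ (lf (h p)).
  by apply: filterS2 nD => q -> /= ->.
case: l => x [] lf; rewrite /theta1 /=; apply: H => //; case: (ds_homeo S x) => _ [] //.
- by move=> *; exact: ds_Hx_clopen.
- by move=> *; exact: ds_Om_clopen.
Qed.

Lemma locconst_theta g (Z : Type) (f : T -> Z) :
  locconst f -> locconst (fun p => omap f (theta S g p)).
Proof.
suff H w : locconst f -> locconst (fun p => omap f (wtheta S w p)) by exact: H.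
elim: w Z f => [|l w IH] Z f lf p /=; first by apply: filterS (lf p) => q ->.
have := IH _ _ (locconst_theta1 l lf) p; apply: filterS => q.
by rewrite -!/(wtheta S w _); case: wtheta; case: wtheta => //= ? ? [].
Qed.

End LocallyConstant.

(** * The space of configurations *)

Section Configurations.
Variable G : sepgraph.
Local Notation F := (freegroup (edge G)).
Implicit Types (x y : edge G) (v : vert G) (A X : {set edge G}) (g h u : F).

(** The edge that A selects in the block X, total in A: when A misses X an arbitrary
    element of X is taken. Thus every A makes exactly one choice in every block,
    and no consistency condition on A is needed. *)
Definition sel A X : option (edge G) :=
  [pick y in if (A :&: X == finset.set0)%SET then X else (A :&: X)%SET].

Lemma sel_in A X y : sel A X = Some y -> y \in X.
Proof.
by rewrite /sel; case: pickP => //= z + [<-]; case: ifP => //; rewrite finset.inE => _ /andP[].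
Qed.

Lemma sel_ex A v X : X \in sep v -> exists2 y, y \in X & sel A X = Some y.
Proof.
move=> /sep_neq0 X0; case E: (sel A X) => [y|]; first by exists y => //; apply: sel_in E.
move: E; rewrite /sel; case: pickP => // n _.
have : (if (A :&: X == finset.set0)%SET then X else (A :&: X)%SET) != finset.set0.
  by case: ifP => [_|->].
by case/finset.set0Pn => z; have := n z; rewrite /= => ->.
Qed.

Lemma sel_uniq A X x : (A :&: X)%SET = [set x]%SET -> sel A X = Some x.
Proof.
rewrite /sel => ->; have /negPf -> : [set x]%SET != finset.set0.
  by apply/finset.set0Pn; exists x; rewrite finset.inE.
case: pickP => [y|/(_ x)] /=; rewrite finset.inE.
  by move/eqP ->.
by rewrite eqxx.
Qed.

(** The label at a group element: [None] if it is not reached, else the vertex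
    and a set of edges encoding the choices made there. *)
Definition cell := option (vert G * {set edge G}).
Implicit Types o : cell.

Definition at_vert v o : bool := if o is Some (u, _) then u == v else false.

Definition chooses x o : bool :=
  if o is Some (u, A) then (u == rng x) && (sel A (block x) == Some x) else false.

Lemma at_vert_inj v v' o : at_vert v o -> at_vert v' o -> v = v'.
Proof. by case: o => [[u A]|] //= /eqP <- /eqP. Qed.

Lemma chooses_vert x o : chooses x o -> at_vert (rng x) o.
Proof. by case: o => [[u A]|] //= /andP[]. Qed.

Lemma chooses_ex v X o : X \in sep v -> at_vert v o -> exists2 x, x \in X & chooses x o.
Proof.
case: o => [[u A]|] //= sX /eqP ->.
have [y yX sy] := sel_ex A sX; exists y => //.
by rewrite (sep_rng sX yX) eqxx (sep_block sX yX) sy /=.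
Qed.

Lemma chooses_inj v X x y o : X \in sep v -> x \in X -> y \in X ->
  chooses x o -> chooses y o -> x = y.
Proof.
case: o => [[u A]|] //= sX xX yX; rewrite (sep_block sX xX) (sep_block sX yX).
by move=> /andP[_ /eqP ->] /andP[_ /eqP [->]].
Qed.

Local Notation gen x := (fgof [:: (x, false)]).

(** If [c g] describes the point $\theta_{g^{-1}}(p)$, then the condition says that this
    point lies in $\Omega_{s(x)}$ exactly when $\theta_x$ sends it into $H_x$. Labels
    that are not connected to 1 are tolerated: a system is needed that maps to
    the universal one, not the universal one itself. *)
Definition legal : set {ptws F -> discrete_topology cell} :=
  [set c | c 1%g <> None /\ forall g x, at_vert (src x) (c g) = chooses x (c (g * (gen x)^-1)%g)].

Definition config : topologicalType := set_type legal.

Definition cval (c : config) : F -> cell := \val c.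

Lemma cval_inj (c c' : config) : cval c = cval c' -> c = c'.
Proof. exact: val_inj. Qed.

Lemma cval_legal (c : config) : legal (cval c).
Proof. exact: set_mem (valP c). Qed.

(** Configurations carry the topology of pointwise convergence to discrete labels. *)
Lemma cvg_config (Fi : set_system config) (c : config) : Filter Fi ->
  (forall g, \forall c' \near Fi, cval c' g = cval c g) -> Fi --> c.
Proof.
move=> FF H U [_ [[W oW <-] /= Wc]] WU.
have cv : (fun c' : config => \val c' : {ptws F -> discrete_topology cell}) @ Fi --> (\val c : {ptws F -> discrete_topology cell}).
  apply/cvg_sup => g; apply/cvg_image.
    rewrite eqEsubset; split=> // z _; by exists (fun=> z).
  move=> V nV.
  exists ((fun f : {ptws F -> discrete_topology cell} => f g) @^-1` V); last first.
    rewrite eqEsubset; split=> [_ [f ? <-] //|z Vz]; by exists (fun=> z).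
  suff : Fi [set c' | V (cval c' g)] by [].
  by apply: filterS (H g) => c' /= ->; exact: (@nbhs_singleton (discrete_topology cell) _ V nV).
have : Fi [set c' | W (cval c')] by exact: (cv W (open_nbhs_nbhs (conj oW Wc))).
by apply: filterS => c' Wc'; exact: WU.
Qed.

Lemma cval_locconst g : locconst (fun c : config => cval c g).
Proof.
apply/locconst_continuous => c.
apply: (@continuous_comp _ {ptws F -> discrete_topology cell} _ (fun c : config => \val c) (fun f => f g)).
  exact: (@initial_continuous _ {ptws F -> discrete_topology cell}).
exact: (@proj_continuous _ (fun=> discrete_topology cell)).
Qed.

Lemma config_hausdorff : hausdorff_space config.
Proof.
move=> c c' cl; apply: cval_inj; apply/funext => g.
have := cl _ _ (cval_locconst g c) (cval_locconst g c').
by case=> d [<- <-].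
Qed.

(** Each instance of the condition only involves finitely many labels. *)
Lemma legal_closed : closed legal.
Proof.
have cl (h : seq F) (P : (F -> cell) -> Prop) :
    (forall f f' : F -> cell, (forall g, g \in h -> f g = f' g) -> P f -> P f') ->
    closed ([set f | P f] : set {ptws F -> discrete_topology cell}).
  move=> Ph f clf.
  have near_seq (Fi : set_system (F -> cell)) : Filter Fi ->
      (forall g, Fi [set f' | f' g = f g]) -> Fi [set f' | forall g, g \in h -> f' g = f g].
    move=> FF Fg; elim: h {Ph} => [|g h IH]; first by apply: nearW => f' g.
    apply: filterS2 (Fg g) IH => f' /= fg fh k.
    by rewrite inE => /predU1P[->//|/fh].
  have nf : forall g, nbhs (f : {ptws F -> discrete_topology cell}) [set f' | f' g = f g].
    by move=> g; exact: (@proj_continuous F (fun=> discrete_topology cell) g f _ (@discrete_set1 (discrete_topology cell) (f g))).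
  have [f' [Pf' /= ff']] := clf _ (near_seq _ (@nbhs_filter {ptws F -> discrete_topology cell} f) nf).
  exact: Ph Pf'.
rewrite (_ : legal = [set c | c 1%g <> None] `&` \bigcap_(gx in [set: F * edge G])
    [set c : F -> cell | at_vert (src gx.2) (c gx.1) = chooses gx.2 (c (gx.1 * (gen gx.2)^-1)%g)]).
  apply: closedI; first by apply: (cl [:: 1%g]) => f f' E; rewrite E // inE.
  apply: closed_bigI => -[g x] _ /=; apply: (cl [:: g; (g * (gen x)^-1)%g]) => f f' E /=.
  by rewrite !E // !inE eqxx ?orbT.
rewrite eqEsubset; split=> [c [c1 cl1]|c [c1 cl1]]; split=> //.
  by move=> -[g x] _ /=.
by move=> g x; exact: (cl1 (g, x)).
Qed.

(** Tychonoff, as there are finitely many labels. *)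
Lemma config_compact : compact [set: config].
Proof.
move=> Fi PF _.
have cT : compact [set: {ptws F -> discrete_topology cell}].
  have := @tychonoff F (fun=> discrete_topology cell) (fun=> setT).
  rewrite (_ : [set f : F -> cell | _] = setT); last by rewrite eqEsubset; split.
  by apply=> _; apply: finite_compact; exact: (@finite_finset _ setT).
have cl := subclosed_compact legal_closed cT (@subsetT _ _).
pose v (c : config) : {ptws F -> discrete_topology cell} := cval c.
have Fl : (v @ Fi) legal by apply: (@filterS _ Fi _ setT) filterT => c _; exact: cval_legal.
have [f [lf clf]] := cl (v @ Fi) _ Fl.
exists (SigSub (mem_set lf)); split=> // A B FA [_ [[W oW <-] /= Wf] WB].
have nW : nbhs f W by apply: open_nbhs_nbhs.
have vA : (v @ Fi) (v @` A) by apply: (@filterS _ Fi _ A) FA => c Ac; exists c.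
have [_ [[c Ac <-] Wc]] := clf (v @` A) W vA nW.
by exists c; split=> //; exact: WB.
Qed.

End Configurations.

(** * The dynamical system of configurations *)

Section ConfigurationSystem.
Variable G : sepgraph.
Local Notation F := (freegroup (edge G)).
Local Notation gen x := (fgof [:: (x, false)]).
Implicit Types (x y : edge G) (v : vert G) (g h u : F) (c : config G).

Definition shift u (c : F -> cell G) : F -> cell G := fun g => c (u^-1 * g)%g.

Lemma legal_shift u (c : F -> cell G) : legal c -> c u^-1%g <> None -> legal (shift u c).
Proof.
move=> [c1 cl] cu; split; first by rewrite /shift mulg1.
by move=> g x; rewrite /shift mulgA cl.
Qed.

(** Translation, with the identity where the translate would have no label at 1. In
    this form it is continuous everywhere. *)
Definition cshift u c : config G := insubd c (shift u (cval c)).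

Lemma cshiftE u c : cval c u^-1%g <> None -> cval (cshift u c) = shift u (cval c).
Proof.
by move=> cu; rewrite /cval /cshift /insubd insubT //; apply/mem_set/legal_shift => //; exact: cval_legal.
Qed.

Lemma cshift_out u c : cval c u^-1%g = None -> cshift u c = c.
Proof.
move=> cu; rewrite /cshift /insubd insubN //.
by apply/negP => /set_mem [+ _]; rewrite /shift mulg1.
Qed.

Lemma cshift_continuous u : continuous (cshift u).
Proof.
move=> c; apply: (cvg_config (fmap_filter _ (nbhs_filter c))) => g.
suff : \forall c' \near c, cval (cshift u c') g = cval (cshift u c) g by [].
near=> c'.
have E1 : cval c' u^-1%g = cval c u^-1%g by near: c'; exact: cval_locconst.
have [E|/eqP E] := eqVneq (cval c u^-1%g) None.
  by rewrite !cshift_out // ?E1 //; near: c'; exact: cval_locconst.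
rewrite !cshiftE //; last by rewrite E1.
by near: c'; exact: cval_locconst.
Unshelve. all: by end_near. Qed.

Definition cOm v : set (config G) := [set c | at_vert v (cval c 1%g)].
Definition cHx x : set (config G) := [set c | chooses x (cval c 1%g)].

Lemma chooses_src c x g : at_vert (src x) (cval c g) = chooses x (cval c (g * (gen x)^-1)%g).
Proof. by case: (cval_legal c) => _ ->. Qed.

Lemma cOm_dom x c : cOm (src x) c -> cval c (gen x)^-1%g <> None.
Proof. by rewrite /cOm /= chooses_src mul1g => + E; rewrite E. Qed.

Lemma cHx_dom x c : cHx x c -> cval c (gen x)^-1^-1%g <> None.
Proof. by rewrite /cHx /= -[1%g](mulgV (gen x)) -chooses_src invgK => + E; rewrite E. Qed.

Lemma cOm_shift x c : cOm (src x) c -> cHx x (cshift (gen x) c).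
Proof.
move=> h; rewrite /cHx /= cshiftE; last exact: cOm_dom.
by move: h; rewrite /cOm /= chooses_src /shift mul1g mulg1.
Qed.

Lemma cHx_shift x c : cHx x c -> cOm (src x) (cshift (gen x)^-1%g c).
Proof.
move=> h; rewrite /cOm /= cshiftE; last exact: cHx_dom.
by rewrite /shift invgK chooses_src mulg1 mulgV.
Qed.

Lemma cshiftK u c : cval c u^-1%g <> None -> cshift u^-1%g (cshift u c) = c.
Proof.
move=> h; apply: cval_inj; rewrite cshiftE.
  by rewrite cshiftE //; apply/funext => g; rewrite /shift invgK mulKg.
rewrite cshiftE // /shift invgK mulVg; by case: (cval_legal c).
Qed.

Lemma config_homeo x : set_homeo (cOm (src x)) (cHx x) (cshift (gen x)) (cshift (gen x)^-1%g).
Proof.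
split; first split.
- exact: cOm_shift.
- exact: cHx_shift.
- by move=> c; rewrite inE => h; apply: cshiftK; exact: cOm_dom.
- move=> c; rewrite inE => h; rewrite -{1}[gen x]invgK; apply: cshiftK; exact: cHx_dom.
- by split; apply: continuous_subspaceT; exact: cshift_continuous.
Qed.

Definition config_sys : dynsys G (config G).
Proof.
refine (@DynSys G (config G) cOm cHx (fun x => cshift (gen x)) (fun x => cshift (gen x)^-1%g)
  (@config_compact G) (@config_hausdorff G) _ _ _ _ _ _ _ config_homeo).
- by move=> v; apply: (@locconst_clopen _ _ (fun c => cval c 1%g) [set o | at_vert v o]); exact: cval_locconst.
- by move=> v v' _ _ [c [h h']]; exact: at_vert_inj h h'.
- rewrite eqEsubset; split=> // c _.
  have [+ _] := cval_legal c; case E: (cval c 1%g) => [[v A]|] // _.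
  by exists v => //; rewrite /cOm /= E /=.
- by move=> x; apply: (@locconst_clopen _ _ (fun c => cval c 1%g) [set o | chooses x o]); exact: cval_locconst.
- by move=> x c; exact: chooses_vert.
- by move=> v X sX x y xX yX [c [h h']]; exact: chooses_inj sX xX yX h h'.
- move=> v X sX; rewrite eqEsubset; split=> [c [x xX h]|c /(chooses_ex sX) [x xX h]].
    by rewrite -(sep_rng sX xX); exact: chooses_vert.
  by exists x.
Defined.

(** Where the partial action is defined, the identity branch of [cshift] is never taken. *)
Lemma theta_config u c c' : theta config_sys u c = Some c' -> cval c' = shift u (cval c).
Proof.
rewrite thetaE -{2}[u]fgwordK; elim: (fgword u) c' => [|l w IH] c' /=.
  by case=> <-; apply/funext => g; rewrite /shift (_ : fgof [::] = 1%g) ?invg1 ?mul1g //; exact: val_inj.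
case E: (wtheta _ w c) => [d|] //= h.
have {}IH := IH _ E.
have -> : shift (fgof (l :: w)) (cval c) = shift (fgof [:: l]) (cval d).
  by rewrite IH; apply/funext => g; rewrite /shift fgof_cons invgM mulgA.
case: l h => x [] h.
  have [hx _] := theta1_negP h; move: h; rewrite theta1_neg // => -[<-] /=.
  by rewrite (fgof_linv (x, false)) cshiftE //; exact: cHx_dom.
have [hx _] := theta1_posP h; move: h; rewrite theta1_pos // => -[<-] /=.
by rewrite cshiftE //; exact: cOm_dom.
Qed.

End ConfigurationSystem.

(** * Itineraries *)

Section Itinerary.
Variables (G : sepgraph) (T : topologicalType) (S : dynsys G T).
Local Notation F := (freegroup (edge G)).
Local Notation gen x := (fgof [:: (x, false)]).
Implicit Types (x y : edge G) (v : vert G) (g h u : F) (p q : T).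

(** The local label of a point: its vertex, with all x such that p lies in $H_x$. *)
Definition loc p : cell G :=
  omap (fun v => (v, [set x | p \in Hx S x]%SET)) [pick v | p \in Om S v].

Lemma locE v p : Om S v p -> loc p = Some (v, [set x | p \in Hx S x]%SET).
Proof.
move=> h; rewrite /loc; case: pickP => [v' /set_mem h'|/(_ v)] /=.
  by rewrite (Om_inj h h').
by rewrite mem_set.
Qed.

Lemma at_vert_loc v p : at_vert v (loc p) <-> Om S v p.
Proof.
have [w hw] := Om_ex S p; rewrite (locE hw) /=.
by split=> [/eqP <- //|h]; apply/eqP; exact: Om_inj hw h.
Qed.

(** Exactly one edge of each block is present in the label of a point, so that
    [sel] never has to fall back on an arbitrary choice. *)
Lemma visitedE v X x p : X \in sep v -> x \in X -> Hx S x p ->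
  ([set x | p \in Hx S x] :&: X = [set x])%SET.
Proof.
move=> sX xX hx; apply/finset.setP => y; rewrite !finset.inE.
apply/andP/eqP => [[/set_mem hy yX]|->]; last by rewrite mem_set.
exact: Hx_inj sX yX xX hy hx.
Qed.

Lemma chooses_loc x p : chooses x (loc p) <-> Hx S x p.
Proof.
have [v hv] := Om_ex S p; rewrite (locE hv) /=; split=> [/andP[/eqP rv /eqP sx]|h].
  have sX : block x \in sep v by rewrite rv block_sep.
  have [y yX hy] := Hx_ex sX hv.
  by move: sx; rewrite (sel_uniq (visitedE sX yX hy)) => -[<-].
rewrite (Om_inj hv (Hx_Om h)) eqxx /=.
by rewrite (sel_uniq (visitedE (block_sep x) (mem_block x) h)).
Qed.

Lemma loc_locconst : locconst loc.
Proof.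
move=> p; have [v hv] := Om_ex S p.
have nO : \forall q \near p, Om S v q.
  by apply: filterS (clopen_locconst (ds_Om_clopen S v) p) => q; rewrite (mem_set hv) => /set_mem.
have nH : \forall q \near p, forall x, (q \in Hx S x) = (p \in Hx S x).
  by apply: filter_forall => x; exact: clopen_locconst (ds_Hx_clopen S x) p.
apply: filterS2 nO nH => q hq H; rewrite (locE hv) (locE hq).
by congr (Some (_, _)); apply/finset.setP => x; rewrite !finset.inE.
Qed.

(** The label of $\theta_{g^{-1}}(p)$, for each g. With this convention the itinerary of
    $\theta_h(p)$ is the left translate by h. *)
Definition itin p : F -> cell G := fun g => obind loc (theta S g^-1%g p).

Lemma loc_some p : loc p <> None.
Proof. by have [w hw] := Om_ex S p; rewrite (locE hw). Qed.

Lemma theta_gen x p : theta S (gen x) p = theta1 S (x, false) p. Proof. by []. Qed.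
Lemma theta_genV x p : theta S (gen x)^-1%g p = theta1 S (x, true) p. Proof. by []. Qed.

Lemma itin_legal p : legal (itin p).
Proof.
split; first exact: loc_some.
move=> g x; rewrite /itin invgM invgK; apply/idP/idP.
- case E: (theta S g^-1%g p) => [q|] //= /at_vert_loc h.
  rewrite -(theta_comp _ E) theta_gen theta1_pos //=; apply/chooses_loc.
  by have [] := theta1_posP (theta1_pos h).
- case E: (theta S _ p) => [q|] //= /chooses_loc h.
  have := theta_comp (gen x)^-1%g E; rewrite mulKg => <-.
  rewrite theta_genV theta1_neg //=; apply/at_vert_loc.
  by have [] := theta1_negP (theta1_neg h).
Qed.

Definition itinerary p : config G := SigSub (mem_set (itin_legal p)).

Lemma itin_locconst g : locconst (fun p => itin p g).
Proof.
move=> p; apply: filterS (locconst_theta S g^-1%g loc_locconst p) => q.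
by rewrite /itin; case: theta; case: theta => //= ? ? [].
Qed.

Lemma itinerary_continuous : continuous itinerary.
Proof.
by move=> p; apply: (cvg_config (fmap_filter _ (nbhs_filter p))) => g; exact: itin_locconst.
Qed.

Lemma itin_theta h p q g : theta S h p = Some q -> itin q g = itin p (h^-1 * g)%g.
Proof. by move=> hp; rewrite /itin (theta_comp _ hp) invgM invgK. Qed.

Lemma itinerary_equivariant : equivariant S (config_sys G) itinerary.
Proof.
split.
- by move=> v _ [p h <-]; apply/at_vert_loc.
- by move=> x _ [p h <-]; apply/chooses_loc.
- move=> x p h; apply: cval_inj; rewrite cshiftE; last first.
    by apply: cOm_dom; apply/at_vert_loc.
  have E : theta S (gen x) p = Some (th S x p) by rewrite theta_gen theta1_pos.
  by apply/funext => g; exact: itin_theta g E.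
Qed.

End Itinerary.

Section Universal.
Variables (G : sepgraph) (T : topologicalType) (S : dynsys G T).
Hypothesis univ : universal S.

(** The universal property gives f; composed with the itinerary map it is an
    equivariant continuous endomorphism of the universal system, hence the
    identity. *)
Lemma itinerary_retract : exists f : config G -> T,
  [/\ continuous f, equivariant (config_sys G) S f & forall p, f (itinerary S p) = p].
Proof.
have [f [[cf ef] _]] := univ (config_sys G); exists f; split=> //.
have [i [_ ui]] := univ S.
have E : f \o itinerary S = id.
  rewrite -(ui id); last by split; [move=> p U|exact: equivariant_id].
  apply/esym/ui; split; last exact: equivariant_comp (itinerary_equivariant S) ef.
  by move=> p; apply: continuous_comp; [exact: itinerary_continuous|exact: cf].
by move=> p; rewrite -[RHS]/(id p) -E.
Qed.

Lemma itin_inj p q : itin S p = itin S q -> p = q.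
Proof.
have [f [_ _ fK]] := itinerary_retract.
move=> E; rewrite -[p]fK -[q]fK; congr f; exact: cval_inj.
Qed.

End Universal.

(** * Growing configurations from a choice of labels *)

Section Growing.
Variable G : sepgraph.
Local Notation F := (freegroup (edge G)).
Local Notation gen x := (fgof [:: (x, false)]).
Local Notation letter := (edge G * bool)%type.
Implicit Types (x y : edge G) (v : vert G) (g h u : F) (w r : seq letter) (l : letter)
  (A : {set edge G}) (phi : seq letter -> {set edge G}).

(** Replaces the choice made by A in the block of x by x. *)
Definition force x A : {set edge G} := (x |: (A :\: block x))%SET.

(** The label after a step along l from a place with label o. The set A provides
    the choices at the new place, except in the block through which it is
    entered, where the choice is imposed by the step. *)
Definition grow1 (o : cell G) l A : cell G :=
  if l.2 then (if at_vert (src l.1) o then Some (rng l.1, force l.1 A) else None)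
  else (if chooses l.1 o then Some (src l.1, A) else None).

(** Words are reversed here, so that the last letter comes first and the
    recursion on the place of arrival is structural. *)
Fixpoint grow v phi r : cell G :=
  if r is l :: r' then grow1 (grow v phi r') l (phi r) else Some (v, phi [::]).

Lemma sel_force x A : sel (force x A) (block x) = Some x.
Proof.
apply: sel_uniq; apply/finset.setP => y; rewrite !finset.inE.
case: (y =P x) => [->|_] /=; first by rewrite mem_block.
by case: (y \in block x); rewrite ?andbF.
Qed.

Lemma grow1_None l A : grow1 None l A = None.
Proof. by case: l => x []. Qed.

(** The place g and its neighbour along x differ by one letter, so one of the two
    labels is grown from the other one in a single step; such a step is
    made exactly when the legality condition asks for it. *)
Lemma grow_legal v phi : legal (fun g => grow v phi (rev (fgword g))).
Proof.
split=> // g x.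
have P r : reduced (rev r) -> rev (fgword (fgof (rev r))) = r.
  by move=> rd; rewrite fgwordE // revK.
have rg : reduced (rev (rev (fgword g))) by rewrite revK fgwordP.
have -> : g = fgof (rev (rev (fgword g))) by rewrite revK fgwordK.
move: (rev (fgword g)) rg => r rd; rewrite P //.
have [E|E] := eqVneq (ohead r) (Some (x, false)).
  (* g ends with x, and its label is grown from that of g x^-1 *)
  case: r E rd => [|l r]; first by [].
  case=> -> rd; rewrite rev_cons -cats1 fgof_cat mulgK P; last exact: reduced_rev_cons rd.
  by rewrite /= /grow1 /=; case: ifP => //= _; rewrite eqxx.
(* g x^-1 is a longer word, and its label is grown from that of g *)
rewrite -(fgof_linv (x, false)) -fgof_cat cats1 -rev_cons P.
  by rewrite /= /grow1 /=; case: ifP => // _; rewrite /= eqxx sel_force eqxx.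
case: r rd E => // m r rd E; apply: reduced_rev_cons2 => //.
by apply: contraNneq E => /= e; rewrite -[m]linvK -e.
Qed.

Definition grown v phi : config G := SigSub (mem_set (grow_legal v phi)).

Lemma grownE v phi w : reduced w -> cval (grown v phi) (fgof w) = grow v phi (rev w).
Proof. by move=> rw; rewrite -[in RHS](fgwordE rw). Qed.

Lemma eq_grow v phi phi' r :
  (forall r', (size r' <= size r)%N -> phi r' = phi' r') -> grow v phi r = grow v phi' r.
Proof.
elim: r => [|l r IH] E /=; first by rewrite E.
by rewrite IH ?E // => r' /leq_trans le; apply: E; apply: le => /=.
Qed.

Lemma walk_grown v phi w : reduced w -> cval (grown v phi) (fgof w) <> None ->
  walk (config_sys G) w (grown v phi) <> None.
Proof.
elim/last_ind: w => // w l IH rd; rewrite grownE // rev_rcons /=.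
have rd' : reduced w by move: rd; rewrite -cats1 => /cat_sorted2[].
have {}IH := IH rd'; rewrite grownE // in IH.
case Ew : (grow v phi (rev w)) => [o|]; last by rewrite grow1_None.
rewrite walk_rcons; case E: (walk _ w _) IH => [c|] /=; last by rewrite Ew => /(_ _) [].
move=> _ h; have c1 : cval c 1%g = Some o.
  rewrite (theta_config (walk_fgof E)) /shift invgK mulg1 grownE //.
case: l rd h => x [] rd; rewrite /grow1 /=; case: ifP => // h _.
  by rewrite theta1_pos //; rewrite /= /cOm /= c1.
by rewrite theta1_neg //; rewrite /= /cHx /= c1.
Qed.

(** A grown configuration has no labels that are disconnected from 1: each one can be
    reached by the partial action. *)
Lemma theta_grown v phi g :
  theta (config_sys G) g^-1%g (grown v phi) <> None <-> cval (grown v phi) g <> None.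
Proof.
split; last first.
  by rewrite thetaV_walk -{1}[g]fgwordK; apply: walk_grown; exact: fgwordP.
case E: (theta _ _ _) => [c|] // _.
have := cval_legal c; rewrite (theta_config E) /shift => -[+ _].
by rewrite invgK mulg1.
Qed.

Variables (T : topologicalType) (S : dynsys G T).

Lemma itin_walk p w : reduced w -> itin S p (fgof w) = obind (loc S) (walk S w p).
Proof. by move=> rd; rewrite /itin thetaV_walk fgwordE. Qed.

Definition visited p : seq letter -> {set edge G} :=
  fun r => if itin S p (fgof (rev r)) is Some (_, A) then A else finset.set0.

(** The itinerary of p is recovered from its vertex and its choices; changing the
    choices at one place then gives new configurations. *)
Lemma itin_grow v p : Om S v p -> itinerary S p = grown v (visited p).
Proof.
move=> hv; apply: cval_inj; apply/funext => g.
rewrite -[g]fgwordK grownE ?fgwordP //; move: (fgword g) (fgwordP g) => w.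
rewrite [LHS](_ : _ = itin S p (fgof w)) //.
elim/last_ind: w => [|w l IH] rd.
  by rewrite (itin_walk p (w := [::])) //= /visited (itin_walk p (w := [::])) //= (locE hv).
have rd' : reduced w by move: rd; rewrite -cats1 => /cat_sorted2[].
move: (IH rd'); rewrite !itin_walk // rev_rcons /= walk_rcons => {}IH.
have vE q' : walk S (rcons w l) p = Some q' -> forall v', Om S v' q' ->
    visited p (l :: rev w) = [set x | q' \in Hx S x]%SET.
  by move=> h v' hv'; rewrite /visited rev_cons revK itin_walk // h /= (locE hv').
move: vE; rewrite walk_rcons; case: (walk S w p) IH => [q|] /= <-; last by rewrite grow1_None.
case: l rd => x [] rd vE; rewrite /grow1 /=.
  have [h|h] := pselect (Om S (src x) q); last first.
    by rewrite theta1_posN //; case: ifP => // /at_vert_loc.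
  have /at_vert_loc -> := h; have h1 := theta1_pos h; have [_ h2] := theta1_posP h1.
  rewrite (vE _ h1 _ (Hx_Om h2)) h1 /= (locE (Hx_Om h2)); congr (Some (_, _)).
  apply/finset.setP => y; have /finset.setP/(_ y) := visitedE (block_sep x) (mem_block x) h2.
  rewrite !finset.inE; case: (y =P x) => [-> /andP[-> //]|_] /=.
  by case: (y \in block x) => //=; rewrite andbT.
have [h|h] := pselect (Hx S x q); last first.
  by rewrite theta1_negN //; case: ifP => // /chooses_loc.
have /chooses_loc -> := h; have h1 := theta1_neg h; have [_ h2] := theta1_negP h1.
by rewrite (vE _ h1 _ h2) h1 /= (locE h2).
Qed.

End Growing.

(** * A branching vertex destroys fixed points *)

Section Freeness.
Variables (G : sepgraph) (T : topologicalType) (S : dynsys G T).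
Local Notation F := (freegroup (edge G)).
Local Notation letter := (edge G * bool)%type.
Implicit Types (e x y : edge G) (v : vert G) (X : {set edge G}) (g h u : F) (p q : T) (w : seq letter) (l : letter).

(** The word in F of the path $\cdots x_3 x_2^* x_1$: since a walk acts by inverse
    letters, the step along $x_1$ is the letter $x_1^{-1}$. The index of [x] starts from
    1, as for paths, and that of the word from 0. *)
Definition path_word (x : nat -> edge G) k : seq letter := mkseq (fun i => (x i.+1, ~~ odd i)) k.

Lemma path_wordS (x : nat -> edge G) k : path_word x k.+1 = rcons (path_word x k) (x k.+1, ~~ odd k).
Proof. exact: mkseqS. Qed.

Lemma admissible_reduced n (x : nat -> edge G) k : admissible n x -> (k <= n)%N -> reduced (path_word x k).
Proof.
case=> _ hB hE; elim: k => [//|[//|k]] IH kn; rewrite !path_wordS.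
apply: reduced_rcons; first by rewrite -path_wordS; apply: IH; lia.
rewrite /linv /= xpair_eqE ?negbK eqxx andbT.
have := odd_double_half k; rewrite -mul2n; case ok: (odd k) => /= dk; apply/eqP => E.
  apply: (hE (k./2 + 1)%N); [lia|lia|].
  have -> : (2 * (k./2 + 1) + 1 = k.+2)%N by lia.
  by have -> : (2 * (k./2 + 1) = k.+1)%N by lia.
apply: (hB (k./2 + 1)%N); [lia|lia|].
have -> : (2 * (k./2 + 1) - 1 = k.+1)%N by lia.
have -> : (2 * (k./2 + 1) = k.+2)%N by lia.
by rewrite E.
Qed.

(** Follow an entry from p as long as the choices of p agree with it. If they do
    until the end, take the block of the entry. If p selects another edge than
    $x_{2i}$, the block of $x_{2i}$ has two elements, and serves instead. *)
Lemma branching_word v p : Om S v p -> branching v ->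
  exists w e X q, [/\ reduced (rcons w (e, true)) /\ (head (e, true) (rcons w (e, true))).2,
    walk S (rcons w (e, true)) p = Some q, X \in sep (rng e) & X <> block e /\ (2 <= #|X|)%N].
Proof.
move=> hv [t [x [t1 adm sx [X sX [XB cX]]]]].
set R := exists w, _.
have mkR i X' q : (i < t)%N -> walk S (path_word x (2 * i).+1) p = Some q ->
    X' \in sep (rng (x (2 * i).+1)) -> X' <> block (x (2 * i).+1) -> (2 <= #|X'|)%N -> R.
  move=> it; have eo : ~~ odd (2 * i) by rewrite mul2n odd_double.
  have E : path_word x (2 * i).+1 = rcons (path_word x (2 * i)) (x (2 * i).+1, true).
    by rewrite path_wordS eo.
  move=> wk *; exists (path_word x (2 * i)), (x (2 * i).+1), X', q; rewrite -E; split=> //.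
  by split; [apply: admissible_reduced adm _; lia|].
suff H i : (i < t)%N -> R \/ exists q, walk S (path_word x (2 * i).+1) p = Some q.
  have [//|[q hq]] := H (t - 1)%N ltac:(lia).
  have E : (2 * t - 1 = (2 * (t - 1)).+1)%N by lia.
  by rewrite E in sX XB; apply: mkR hq sX XB cX; lia.
elim: i => [|i IH] it.
  by right; exists (th S (x 1%N) p); rewrite /path_word /walk /= theta1_pos // sx.
have [HR|[q hq]] := IH (ltnW it); first by left.
have [[eR eS] eB _] := adm.
have iE : (2 * i.+1 - 1 = (2 * i).+1)%N by lia.
have iE2 : (2 * i.+1 = (2 * i).+2)%N by lia.
have eo : odd (2 * i) = false by rewrite mul2n odd_double.
have hx : Hx S (x (2 * i).+1) q.
  move: hq; rewrite path_wordS eo walk_rcons; case: walk => //= q'.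
  by case/theta1_posP.
have rr : rng (x (2 * i).+1) = rng (x (2 * i).+2).
  by have := eR i.+1 ltac:(lia) ltac:(lia); rewrite iE iE2.
have bb : block (x (2 * i).+1) <> block (x (2 * i).+2).
  by have := eB i.+1 ltac:(lia) ltac:(lia); rewrite iE iE2.
have ss : src (x (2 * i).+2) = src (x (2 * i).+3).
  have := eS i.+1 ltac:(lia) ltac:(lia); rewrite iE2.
  by have -> : ((2 * i).+2 + 1 = (2 * i).+3)%N by lia.
have [h2|h2] := pselect (Hx S (x (2 * i).+2) q); last first.
  left; have sB := block_sep (x (2 * i).+2); rewrite -rr in sB.
  have [z zB hz] := Hx_ex sB (Hx_Om hx).
  apply: (mkR i _ q _ hq sB) => //; [lia|exact: nesym|].
  have : ([set z; x (2 * i).+2] \subset block (x (2 * i).+2))%SET.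
    by rewrite finset.subUset !finset.sub1set mem_block zB.
  move/subset_leq_card; rewrite finset.cards2; case: eqP => // E.
  by rewrite E in hz.
right; rewrite iE2 2!path_wordS. rewrite 2!walk_rcons hq /= eo /=.
have h3 := theta1_neg h2; have [_ h4] := theta1_negP h3.
rewrite h3 /=; exists (th S (x (2 * i).+3) (thV S (x (2 * i).+2) q)).
by rewrite theta1_pos // -ss.
Qed.

Definition cyc_reduced w : Prop := w <> [::] /\ forall l, last l w != linv (head l w).

Lemma size_flatten_nseq m w : w <> [::] -> (m <= size (flatten (nseq m w)))%N.
Proof. by case: w => // l w _; elim: m => //= m IH; rewrite size_cat /=; lia. Qed.

(** No cancellation occurs at any of the junctions. *)
Lemma power_reduced m w w1 l : cyc_reduced w -> reduced w -> reduced w1 -> w1 <> [::] ->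
  last l w != linv (head l w1) -> reduced (flatten (nseq m w) ++ w1).
Proof.
move=> [w0 cw] rw rw1 w10 lw; elim: m => //= m IH; rewrite -catA.
apply: (@reduced_cat _ _ _ l) => //; first exact/eqP.
  by case: (w1) w10 => // a b _; case: flatten.
have linvC a b : (a != linv b) = (b != linv a).
  by congr (~~ _); apply/eqP/eqP => ->; rewrite linvK.
rewrite linvC; case: m {IH} => //= m; case: (w) w0 cw => //= a b _ cw; exact: cw a.
Qed.

Hypothesis univ : universal S.

(** The itinerary of p is altered at the single place $g^n z_0$, which tends to
    infinity with n; periodicity under g carries the defined place $z_0 x$ to the
    place $g^n z_0 x$, which the alteration has removed. *)
Lemma no_fixed_branching g (V : set T) v p : open V -> (forall q, V q -> theta S g q = Some q) ->
  V p -> Om S v p -> branching v -> cyc_reduced (fgword g) -> False.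
Proof.
move=> oV fixV Vp hv br cg.
have [w0 [e [X [q [[rW hW] wk sX [XB cX]]]]]] := branching_word hv br.
set W := rcons w0 (e, true) in rW hW wk.
pose l0 : letter := (e, true).
(* cyclic reducedness leaves room for z0 after g or after its inverse *)
wlog lg : g fixV cg / last l0 (fgword g) != linv (head l0 W).
  move=> H; have [E|] := eqVneq (last l0 (fgword g)) (linv (head l0 W)); last exact: H.
  have fixV' q' : V q' -> theta S g^-1%g q' = Some q' by move/fixV; exact: theta_inv.
  have [g0 cg'] := cg.
  have lastV l : last l (fgword g^-1%g) = linv (head l (fgword g)).
    by rewrite fgwordV; case: (fgword g) g0 => // a b _; rewrite /= rev_cons last_rcons.
  have headV l : head l (fgword g^-1%g) = linv (last l (fgword g)).
    by rewrite fgwordV; case/lastP: (fgword g) g0 => // a b _; rewrite map_rcons rev_rcons last_rcons.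
  apply: (H g^-1%g) => //.
    split; first by rewrite fgwordV; case: (fgword g) g0 => // a b _; rewrite /= rev_cons; case: rev.
    by move=> l; rewrite lastV headV linvK eq_sym.
  rewrite lastV; apply/eqP => /(can_inj (@linvK _)) E'.
  by have := cg' l0; rewrite E E' eqxx.
have [g0 _] := cg.
have W0 : W <> [::] by rewrite /W; case: (w0).
have he : Hx S e q.
  by move: wk; rewrite /W walk_rcons; case: walk => //= q' /theta1_posP[].
(* x is the edge selected by p in the block X, and y another one *)
have [x xX hx] := Hx_ex sX (Hx_Om he).
have [y yX yx] : exists2 y, y \in X & y <> x.
  have /card_gt1P [a [b [aX bX ab]]] := cX.
  by have [ax|/eqP ax] := eqVneq a x; [exists b => //; rewrite -ax; apply/eqP; rewrite eq_sym|exists a].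
have xe : x <> e by move=> E; apply: XB; rewrite -E (sep_block sX xX).
pose pw n := flatten (nseq n (fgword g)) ++ W.
have pwr n : rcons (pw n) (x, false) = rcons (rcons (flatten (nseq n (fgword g)) ++ w0) (e, true)) (x, false).
  by rewrite /pw /W -rcons_cat.
have rpw n : reduced (pw n) by apply: (@power_reduced _ _ _ l0) => //; exact: fgwordP.
have rpwx n : reduced (rcons (pw n) (x, false)).
  rewrite pwr; apply: reduced_rcons; first by rewrite rcons_cat; exact: rpw.
  by rewrite /linv xpair_eqE /= andbT; apply/eqP.
have spw n : (n < size (pw n))%N /\ (n + size W <= size (pw n))%N.
  rewrite /pw size_cat /W size_rcons.
  have le := @size_flatten_nseq n _ g0; rewrite leq_add2r le; split=> //.
  by rewrite addnS ltnS (leq_trans le) // leq_addr.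
pose phi n r := if r == rev (pw n) then [set y]%SET else visited S p r.
pose c_ n := grown v (phi n).
have [f [cf ef fK]] := itinerary_retract univ.
have c0E := itin_grow hv.
have cE n h : (size (fgword h) < size (pw n))%N -> cval (c_ n) h = cval (itinerary S p) h.
  move=> sh; rewrite c0E -[h]fgwordK !grownE ?fgwordP //; apply: eq_grow => r.
  rewrite size_rev => sr; rewrite /phi; case: eqP => // E.
  by move: sr; rewrite E size_rev leqNgt sh.
have cvg : c_ @ \oo --> itinerary S p.
  apply: (cvg_config (fmap_filter _ _)) => h.
  suff : \forall n \near \oo, cval (c_ n) h = cval (itinerary S p) h by [].
  by exists (size (fgword h)) => // n /= hn; apply: cE; apply: leq_ltn_trans hn _; case: (spw n).
have [N _ HN] : \forall n \near \oo, V (f (c_ n)).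
  have : nbhs (f (itinerary S p)) V by rewrite fK; apply: open_nbhs_nbhs.
  by move/cf/cvg.
(* beyond size W, the place z0 x is closer to 1 than the altered one *)
pose n := maxn N (size W).+1.
have /= Vn := HN n (leq_maxl _ _).
set q' := f (c_ n) in Vn.
have def h : theta S h^-1%g q' <> None <-> cval (c_ n) h <> None.
  rewrite /q' (equivariant_theta ef) -theta_grown.
  by case: theta.
have hW1 : cval (c_ n) (fgof (rcons W (x, false))) <> None.
  have rWx := rpwx 0%N; rewrite /pw /= in rWx.
  rewrite cE; last first.
    rewrite fgwordE // size_rcons; case: (spw n) => _; have : (size W < n)%N by exact: leq_maxr.
    by rewrite /W size_rcons; lia.
  rewrite [cval _ _](_ : _ = itin S p (fgof (rcons W (x, false)))) //.
  rewrite itin_walk // walk_rcons wk /= theta1_neg //=; exact: loc_some.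
pose gm := fgof (flatten (nseq n (fgword g))).
have gmq : theta S gm q' = Some q'.
  rewrite /gm; elim: (n) => //= m IH.
  by rewrite fgof_cat fgwordK -(theta_comp _ IH); exact: fixV.
have : cval (c_ n) (gm * fgof (rcons W (x, false)))%g <> None.
  by apply/def; rewrite invgM -(theta_comp _ (theta_inv gmq)); apply/def.
rewrite -fgof_cat -rcons_cat -/(pw n) grownE // rev_rcons /= /grow1 /=; case: ifP => // + _.
(* at the altered place y was forced on the block X, so x is not selected *)
have -> : rev (pw n) = (e, true) :: rev (flatten (nseq n (fgword g)) ++ w0).
  by rewrite /pw /W -rcons_cat rev_rcons.
rewrite /= /grow1 /=; case: ifP => //= _ /andP[_].
have -> : phi n ((e, true) :: rev (flatten (nseq n (fgword g)) ++ w0)) = [set y]%SET.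
  by rewrite /phi /pw /W -rcons_cat rev_rcons eqxx.
rewrite (sep_block sX xX) (@sel_uniq _ _ _ y); first by move=> /eqP [].
apply/finset.setP => z; rewrite !finset.inE.
apply/andP/eqP => [[/predU1P[->|/andP[_ /eqP]] //]|->].
  by move=> eX; case: XB; rewrite (sep_block sX eX).
split=> //; apply/orP; right; rewrite eqxx andbT.
apply/negP => yB; apply: XB.
exact: sep_disjoint sX (block_sep e) yX yB.
Qed.

End Freeness.

(** * Topological freeness *)

Section TopologicalFreeness.
Variables (G : sepgraph) (E00 E01 : {set vert G}).
Hypotheses (hbip : bipartite E00 E01) (hL : conditionL G).
Variables (T : topologicalType) (S : dynsys G T).
Local Notation F := (freegroup (edge G)).
Local Notation letter := (edge G * bool)%type.
Implicit Types (x y : edge G) (v : vert G) (X : {set edge G}) (g h u : F) (p q : T) (w : seq letter) (l : letter).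

Lemma src_E01 x : src x \in E01.
Proof. by case: hbip => _ _ /(_ x)[]. Qed.

Lemma rng_E01 x : rng x \notin E01.
Proof.
case: hbip => _ dis /(_ x)[_ h0] _ _; apply/negP => h1.
have : rng x \in (E00 :&: E01)%SET by rewrite finset.inE h0.
by rewrite dis finset.inE.
Qed.

(** By bipartiteness, a step along $x^{-1}$ leads from $E^{0,1}$ to $E^{0,0}$ and a step
    along x leads back. *)
Lemma step_letter l p q v : Om S v p -> theta1 S (linv l) p = Some q ->
  (v \in E01) = l.2 /\ exists2 v', Om S v' q & (v' \in E01) = ~~ l.2.
Proof.
case: l => x [] hv; rewrite /linv /=.
- case/theta1_posP => h1 h2; rewrite (Om_inj hv h1) src_E01; split=> //.
  by exists (rng x); [exact: Hx_Om|rewrite (negPf (rng_E01 x))].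
- case/theta1_negP => h1 h2; rewrite (Om_inj hv (Hx_Om h1)) (negPf (rng_E01 x)); split=> //.
  by exists (src x) => //; exact: src_E01.
Qed.

Lemma walk_letters w l0 p q v : v \in E01 -> Om S v p -> walk S w p = Some q ->
  forall k, (k <= size w)%N -> exists qk vk, [/\ walk S (take k w) p = Some qk, Om S vk qk,
    (vk \in E01) = ~~ odd k & (k < size w)%N -> (nth l0 w k).2 = ~~ odd k].
Proof.
move=> v1 hv hw; elim=> [|k IH] kw.
  exists p, v; rewrite take0 v1; split=> //.
  case: (w) hw => // l w' hw _ /=.
  move: hw; rewrite -cat1s walk_cat /walk /=; case E: theta1 => [r|]; last by elim: (w').
  by move=> _; have [<- _] := step_letter hv E.
have [qk [vk [hqk hvk vk1 nk]]] := IH (ltnW kw).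
have step j qj : (j < size w)%N -> walk S (take j w) p = Some qj ->
    exists2 q', theta1 S (linv (nth l0 w j)) qj = Some q' & walk S (take j.+1 w) p = Some q'.
  move=> jw hj; move: hw; rewrite -{1}[w](cat_take_drop j.+1) walk_cat.
  by rewrite (take_nth l0) // walk_rcons hj /=; case: theta1 => // q' _; exists q'.
have [q' h1 h2] := step k qk kw hqk.
have [_ [v' hv' v'1]] := step_letter hvk h1.
exists q', v'; split=> //; first by rewrite v'1 nk.
move=> kw'; have [q'' h3 h4] := step k.+1 q' kw' h2.
by have [<- _] := step_letter hv' h3; rewrite v'1 nk.
Qed.

(** Read at a fixed point over $E^{0,1}$, the word of g alternates between $x^{-1}$ and y,
    and so describes a closed path: at a point of $\Omega_{r(x)}$ two different edges
    x, y with $H_x$ and $H_y$ through the point lie in different blocks, and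
    reducedness says that consecutive edges differ. *)
Lemma fixed_branching g p v : g != 1%g -> theta S g p = Some p -> v \in E01 -> Om S v p ->
  exists w1 w2 q v', [/\ fgword g = w1 ++ w2, walk S w1 p = Some q, Om S v' q & branching v'].
Proof.
move=> g1 gp v1 hv; have := fgwordP g; set w := fgword g => rw.
have wp : walk S w p = Some p by rewrite -thetaV_walk; exact: theta_inv.
have [l0 w0] : exists l0 : letter, (0 < size w)%N.
  rewrite /w; case E: (fgword g) => [|l0 w']; last by exists l0.
  by move: g1; rewrite (_ : g = 1%g) ?eqxx //; exact: val_inj.
have letters := walk_letters l0 v1 hv wp.
pose e k := (nth l0 w k.-1).1.
have nthE k : (k < size w)%N -> nth l0 w k = (e k.+1, ~~ odd k).
  move=> kw; have [_ [_ [_ _ _ /(_ kw) <-]]] := letters k (ltnW kw).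
  by rewrite /e /=; case: nth.
have stepE k : (k < size w)%N -> exists q q', [/\ walk S (take k w) p = Some q,
    walk S (take k.+1 w) p = Some q' & theta1 S (e k.+1, odd k) q = Some q'].
  move=> kw; have [q [_ [hq _ _ _]]] := letters k (ltnW kw).
  have [q' [_ [hq' _ _ _]]] := letters k.+1 kw.
  exists q, q'; split=> //.
  by move: hq'; rewrite (take_nth l0) // walk_rcons hq /= nthE // /linv /= negbK.
have evw : ~~ odd (size w).
  have [q [v' [hq hv' <- _]]] := letters _ (leqnn _).
  move: hq; rewrite take_size wp => -[qE]; rewrite -qE in hv'.
  by rewrite (Om_inj hv' hv).
pose r := (size w)./2.
have wr : size w = (2 * r)%N by rewrite mul2n /r -[LHS]odd_double_half (negPf evw).
have redE k : (k.+1 < size w)%N -> e k.+2 <> e k.+1.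
  move=> kw E; have := rw; rewrite /reduced => /(sortedP l0)/(_ k kw).
  by rewrite !nthE //; [rewrite /linv /= E negbK eqxx|exact: ltnW].
have at_peak i : (1 <= i)%N -> (2 * i <= size w)%N ->
    exists q, Hx S (e (2 * i - 1)%N) q /\ Hx S (e (2 * i)%N) q.
  move=> i1 iw; have [iE1 iE2] : (2 * i - 1 = (2 * i.-1).+1)%N /\ (2 * i = (2 * i.-1).+2)%N by lia.
  rewrite iE1 iE2; have eo : odd (2 * i.-1) = false by rewrite mul2n odd_double.
  have [q0 [q [_ hq h1]]] := stepE (2 * i.-1)%N ltac:(lia).
  have [q' [q'' [hq' _ h2]]] := stepE (2 * i.-1).+1%N ltac:(lia).
  move: hq'; rewrite hq => -[qE]; rewrite -qE /= eo in h2; rewrite eo in h1.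
  exists q; split; first by have [] := theta1_posP h1.
  by have [] := theta1_negP h2.
have at_valley i : (2 * i < size w)%N -> exists q, [/\ walk S (take (2 * i) w) p = Some q,
    Om S (src (e (2 * i).+1)) q & (1 <= i)%N -> Om S (src (e (2 * i)%N)) q].
  move=> iw; have eo : odd (2 * i) = false by rewrite mul2n odd_double.
  have [q [q' [hq _ h1]]] := stepE (2 * i)%N iw; rewrite eo in h1.
  exists q; split=> //; first by have [] := theta1_posP h1.
  move=> i1; have iE : (2 * i = (2 * i - 1).+1)%N by lia.
  have [q0 [q1 [_ hq1 h2]]] := stepE (2 * i - 1)%N ltac:(lia).
  move: hq1; rewrite -iE hq => -[qE].
  have eo' : odd (2 * i - 1) by move: eo; rewrite {1}iE /= => /negbFE.
  by rewrite -qE -iE eo' in h2; have [] := theta1_negP h2.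
have cl : closed_path r e.
  split; first lia.
    split.
    - split=> i i1 ir.
        have [q [h1 h2]] := at_peak i i1 ltac:(lia).
        exact: Om_inj (Hx_Om h1) (Hx_Om h2).
      have [q [_ h1 h2]] := at_valley i ltac:(lia).
      by rewrite addn1; exact: Om_inj (h2 i1) h1.
    - move=> i i1 ir E; have [q [h1 h2]] := at_peak i i1 ltac:(lia).
      have [iE1 iE2] : (2 * i - 1 = (2 * i.-1).+1)%N /\ (2 * i = (2 * i.-1).+2)%N by lia.
      apply: (@redE (2 * i.-1)%N); first lia.
      rewrite -iE2 -iE1; apply/esym; apply: (Hx_inj (block_sep _) _ _ h1 h2); first exact: mem_block.
      by rewrite E mem_block.
    - move=> i i1 ir E; have iE : (2 * i = (2 * i - 1).+1)%N by lia.
      apply: (@redE (2 * i - 1)%N); first lia.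
      rewrite -iE -E; congr e; lia.
  have [q [hq h1 _]] := at_valley 0%N ltac:(lia).
  move: hq; rewrite muln0 take0 => -[qE]; rewrite -qE in h1.
  have iE : (2 * r = (2 * r - 1).+1)%N by lia.
  have [q0 [q1 [_ hq1 h2]]] := stepE (2 * r - 1)%N ltac:(lia).
  move: hq1; rewrite -iE -wr take_size wp => -[q1E].
  have eo' : odd (2 * r - 1) by move: evw; rewrite wr {1}iE /= negbK.
  rewrite -q1E -iE eo' in h2; have [_ h3] := theta1_negP h2.
  by rewrite -wr in h3 *; exact: Om_inj h1 h3.
have [i [i1 ir br]] := closed_path_branching hL cl.
have [iE ilt] : (2 * i - 1 = (2 * i.-1).+1)%N /\ (2 * i.-1 < size w)%N by lia.
have [q [hq h1 _]] := at_valley i.-1 ilt.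
exists (take (2 * i.-1) w), (drop (2 * i.-1) w), q, (src (e (2 * i.-1).+1)).
by rewrite cat_take_drop -iE; split=> //; rewrite iE.
Qed.

Hypothesis univ : universal S.

Definition fixes_clopen g p : Prop :=
  exists V : set T, [/\ clopen V, V p & forall q, V q -> theta S g q = Some q].

(** Fixed clopen sets are transported by the partial action. *)
Lemma fixes_clopen_conj g u p q : fixes_clopen g p -> theta S u p = Some q ->
  fixes_clopen (u * g * u^-1)%g q.
Proof.
move=> [V [cV Vp fV]] up; have uq := theta_inv up.
exists [set r | omap (fun r => r \in V) (theta S u^-1%g r) = Some true]; split.
- apply: (@locconst_clopen _ _ (fun r => omap (fun r => r \in V) (theta S u^-1%g r)) [set Some true]).
  by apply: locconst_theta; exact: clopen_locconst.
- by rewrite /= uq /= mem_set.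
- move=> r /=; case E: theta => [s|] //= [/set_mem Vs].
  have {}E' := theta_inv E; rewrite invgK in E'.
  by rewrite -(theta_comp _ E) -(theta_comp _ (fV s Vs)) E'.
Qed.

Lemma fixes_rotate g p w1 w2 q : fixes_clopen g p -> fgword g = w1 ++ w2 ->
  walk S w1 p = Some q -> fixes_clopen (fgof (w2 ++ w1)) q.
Proof.
move=> fg gE /walk_fgof h; have := fixes_clopen_conj fg h.
by rewrite -[g]fgwordK gE !fgof_cat mulKg invgK.
Qed.

Lemma fgof_rotate_neq1 g w1 w2 : g != 1%g -> fgword g = w1 ++ w2 -> fgof (w2 ++ w1) != 1%g.
Proof.
move=> g1 gE; apply: contraNneq g1 => E; rewrite -[g]fgwordK gE fgof_cat.
move: E; rewrite fgof_cat => E; have -> : fgof w2 = (fgof w1)^-1%g.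
  by apply: (@mulIg _ (fgof w1)); rewrite E mulVg.
by rewrite mulgV.
Qed.

(** By strong induction on the length of g. If the word of g begins with a and ends
    with the inverse of a, then conjugation by a gives a shorter element; so every
    fixing element of this length or less is cyclically reduced, and stays so
    under rotation. Rotations move the base point to $E^{0,1}$, and then to a
    branching vertex. *)
Lemma no_fixes g p : g != 1%g -> ~ fixes_clopen g p.
Proof.
elim/ltn_ind: {g}(size (fgword g)) {-2}g p (erefl (size (fgword g))) => n IH g p gn g1 fg.
have cyc g' p' : g' != 1%g -> fixes_clopen g' p' -> (size (fgword g') <= n)%N -> cyc_reduced (fgword g').
  move=> g'1 fg' s'.
  have g'0 : fgword g' <> [::].
    by move=> E; move/eqP: g'1; apply; exact: val_inj.
  split=> // l; apply/eqP => E.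
  have p'p' : walk S (fgword g') p' = Some p'.
    by rewrite -thetaV_walk; case: fg' => V [_ Vp fV]; exact: theta_inv (fV _ Vp).
  case E2: (fgword g') g'0 E p'p' => [//|a w] _ /=.
  case/lastP: w E2 => [|w b] E2 /=; first by move=> E; have := linv_neq a; rewrite -E eqxx.
  rewrite last_rcons => bE; rewrite -cat1s walk_cat.
  case E3: (walk S [:: a] p') => [q|] //= _.
  have E4 : fgword g' = [:: a] ++ rcons w b by [].
  have := fixes_rotate fg' E4 E3.
  have := fgof_rotate_neq1 g'1 E4.
  have -> : fgof (rcons w b ++ [:: a]) = fgof w.
    by rewrite -cats1 !fgof_cat bE fgof_linv mulgVK.
  move=> w1 fw; apply: (IH _ _ (fgof w) q (erefl _) w1 fw).
  by apply: leq_ltn_trans (size_fgof w) _; apply: leq_trans s'; rewrite E2 /= size_rcons.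
have rot g' p' w1 w2 q : g' != 1%g -> fixes_clopen g' p' -> (size (fgword g') <= n)%N ->
    fgword g' = w1 ++ w2 -> walk S w1 p' = Some q ->
    [/\ fgof (w2 ++ w1) != 1%g, fixes_clopen (fgof (w2 ++ w1)) q & (size (fgword (fgof (w2 ++ w1))) <= n)%N].
  move=> g'1 fg' s' E wq; split; [exact: fgof_rotate_neq1 E|exact: fixes_rotate fg' E wq|].
  by apply: leq_trans (size_fgof _) _; rewrite size_cat addnC -size_cat -E.
have core g' p' v : g' != 1%g -> fixes_clopen g' p' -> (size (fgword g') <= n)%N ->
    v \in E01 -> Om S v p' -> False.
  move=> g'1 fg' s' v1 hv.
  have g'p' : theta S g' p' = Some p' by case: fg' => V [_ Vp]; exact.
  have [w1 [w2 [q [v' [E wq hq br]]]]] := fixed_branching g'1 g'p' v1 hv.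
  have [g''1 fg'' s''] := rot _ _ _ _ _ g'1 fg' s' E wq.
  have [V [cV Vq fV]] := fg''.
  have cg := cyc _ _ g''1 fg'' s''.
  exact (no_fixed_branching univ cV.1 fV Vq hq br cg).
have [v hv] := Om_ex S p; have [v1|v1] := boolP (v \in E01).
  by apply: core g1 fg _ v1 hv; rewrite gn.
have wp : walk S (fgword g) p = Some p.
  by rewrite -thetaV_walk; case: fg => V [_ Vp fV]; exact: theta_inv (fV _ Vp).
case E: (fgword g) wp => [|a w].
  by move=> _; move/eqP: g1; apply; exact: val_inj.
rewrite -cat1s walk_cat; case E3: (walk S [:: a] p) => [q|] //= _.
have [aE [v' hv' v'1]] := step_letter hv E3.
have [g'1 fg' s'] := rot g p [:: a] w q g1 fg ltac:(by rewrite gn) E E3.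
by apply: core g'1 fg' s' _ hv'; rewrite v'1 -aE.
Qed.

Lemma topologically_free g (V : set T) : g != 1%g -> clopen V -> V !=set0 ->
  exists2 q, V q & theta S g q <> Some q.
Proof.
move=> g1 cV [p Vp]; apply: contrapT => H; apply: (@no_fixes g p g1); exists V; split=> // q Vq.
by apply: contrapT => h; apply: H; exists q.
Qed.

(** Elements are treated one by one. A point q of V that g does not fix either
    leaves the domain of $\theta_g$, or is separated from $\theta_g(q)$ by one label of the
    itinerary. Both conditions are clopen. *)
Lemma wandering_clopen (V : set T) (s : seq F) : clopen V -> V !=set0 -> (1%g \notin s) ->
  exists W : set T, [/\ clopen W, W !=set0, W `<=` V &
    forall g p q, g \in s -> W p -> W q -> theta S g p <> Some q].
Proof.
elim: s V => [|g s IH] V cV V0; first by exists V; split.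
rewrite inE negb_or eq_sym => /andP[g1 s1].
suff [W1 [cW1 W10 W1V W1g]] : exists W : set T, [/\ clopen W, W !=set0, W `<=` V &
    forall p q, W p -> W q -> theta S g p <> Some q].
  have [W [cW W0 WW1 Wg]] := IH W1 cW1 W10 s1; exists W; split=> //; first exact: subset_trans WW1 W1V.
  by move=> h p q; rewrite inE => /predU1P[-> Wp Wq|]; [apply: W1g; exact: WW1|exact: Wg].
have [q Vq gq] := topologically_free g1 cV V0.
case E: (theta S g q) gq => [r|] gq; last first.
  exists (V `&` [set p | omap (fun=> tt) (theta S g p) = None]); split.
  - apply: clopenI => //; apply: (@locconst_clopen _ _ (fun p => omap (fun=> tt) (theta S g p)) [set None]).
    by apply: locconst_theta => p; exact: nearW.
  - by exists q; rewrite /= E.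
  - by move=> p [].
  - by move=> p p' [_ /=]; case: theta.
have [h hqr] : exists h, itin S q h <> itin S r h.
  apply: contrapT => H; apply: gq; congr Some; apply/esym/(itin_inj univ)/funext => h.
  by apply: contrapT => E'; apply: H; exists h.
have lc := itin_locconst S h.
exists (V `&` ([set p | itin S p h = itin S q h] `&`
  [set p | omap (fun p => itin S p h) (theta S g p) = Some (itin S r h)])); split.
- apply: clopenI => //; apply: clopenI.
    exact: (@locconst_clopen _ _ (fun p => itin S p h) [set itin S q h]).
  apply: (@locconst_clopen _ _ (fun p => omap (fun p => itin S p h) (theta S g p)) [set Some (itin S r h)]).
  exact: locconst_theta.
- by exists q; rewrite /= E.
- by move=> p [].
- move=> p p' [_ [_ /= H]] [_ [H' _]] gp; apply: hqr.
  by move: H; rewrite gp /= H' => -[].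
Qed.

End TopologicalFreeness.

(** * Compression by a small projection *)

Local Open Scope ring_scope.

Section Compression.
Variables (G : sepgraph) (T : topologicalType) (S : dynsys G T) (K : fieldType).
Local Notation F := (freegroup (edge G)).
Implicit Types (g h k : F) (a b : F -> T -> K) (f : T -> K) (p q : T).

Lemma fsum_single (f : F -> T -> K) g : (forall g', g' != g -> f g' = 0) ->
  \sum_(g' \in [set: F]) f g' = f g.
Proof.
move=> f0; rewrite -(fsbig_widen [set g] [set: F]) ?fsbig_set1 //.
by move=> g' /= [_ /eqP g'g]; exact: f0.
Qed.

Lemma alpha0 g : alpha S g (0 : T -> K) = 0.
Proof. by apply/funext => p; rewrite /alpha; case: theta. Qed.

Lemma alpha1 f : alpha S 1%g f = f.
Proof. by apply/funext => p; rewrite /alpha invg1. Qed.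

Lemma alpha_conj g f f' p :
  alpha S g (alpha S g^-1%g f * f') p =
  if theta S g^-1%g p is Some q then f p * f' q else 0.
Proof.
rewrite /alpha; case E: (theta S g^-1%g p) => [q|] //=.
by rewrite [LHS]/GRing.mul /= (theta_inv E).
Qed.

Lemma crossM_delta1l f a : crossM S (delta f 1%g) a = fun g => f * a g.
Proof.
apply/funext => k; rewrite /crossM (@fsum_single _ 1%g).
  by rewrite /delta eqxx !invg1 !alpha1 mul1g.
by move=> g g1; rewrite /delta (negPf g1) alpha0 mul0r alpha0.
Qed.

Lemma crossM_deltar a f g : crossM S a (delta f g) =
  fun k => alpha S (k * g^-1)%g (alpha S (k * g^-1)^-1%g (a (k * g^-1)%g) * f).
Proof.
apply/funext => k; rewrite /crossM (@fsum_single _ (k * g^-1)%g).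
  by rewrite /delta invgM invgK mulgVK eqxx.
move=> h hk; rewrite /delta; case: eqP => [E|_]; last by rewrite mulr0 alpha0.
by move: hk; rewrite -E invgM invgK mulVKg eqxx.
Qed.

Lemma egE g p : eg S K g p = (if theta S g^-1%g p is Some _ then 1 else 0).
Proof.
rewrite /eg indicE; case: (boolP (p \in Ug S g)) => [/set_mem|/negP h].
  by rewrite /Ug /=; case: theta.
by case E: theta => [q|] //; case: h; apply/mem_set; rewrite /Ug /= E.
Qed.

(** At p, compression by f multiplies the coefficient of k by f(p) and by f at the
    image of p under $\theta_{k^{-1}}$. *)
Lemma compressionE f a g k p :
  crossM S (crossM S (crossM S (delta f 1%g) a) (delta (eg S K g) g)) (delta f 1%g) k p =
  match theta S (k * g^-1)^-1%g p, theta S k^-1%g p with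
  | Some q, Some r => f p * a (k * g^-1)%g p * eg S K g q * f r
  | _, _ => 0
  end.
Proof.
rewrite crossM_deltar crossM_deltar crossM_delta1l invg1 mulg1 alpha_conj.
case: (theta S k^-1%g p) => [r|]; last by case: theta.
by rewrite alpha_conj; case: theta => [q|] //; rewrite mul0r.
Qed.

Lemma Ug_clopen g : clopen (Ug S g).
Proof.
rewrite (_ : Ug S g = (fun p => omap (fun=> tt) (theta S g^-1%g p)) @^-1` [set Some tt]).
  by apply: locconst_clopen; apply: locconst_theta => p; exact: nearW.
by apply/seteqP; split=> p; rewrite /Ug /=; case: theta.
Qed.

Lemma indic_CK (W : set T) : clopen W -> CK (\1_W : T -> K).
Proof.
move=> cW; apply/locconst_continuous => p; apply: filterS (clopen_locconst cW p) => q.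
by rewrite !indicE => ->.
Qed.

Lemma cst_CK (c : K) : CK (cst c : T -> K).
Proof. by apply/locconst_continuous => p; exact: nearW. Qed.

Lemma delta_crossed f g : Dg S g f -> crossed S (delta f g).
Proof.
move=> fg; split.
  apply: (@sub_finite_set _ _ [set g]) => // h /=; rewrite /delta.
  by case: eqP.
move=> h; rewrite /delta; case: eqP => [-> //|_]; exists (cst 0); first exact: cst_CK.
by apply/funext => p; rewrite [LHS]/GRing.mul /= mulr0.
Qed.

Lemma delta1_crossed f : CK f -> crossed S (delta f 1%g).
Proof.
move=> cf; apply: delta_crossed; exists f => //; apply/funext => p.
by rewrite [LHS]/GRing.mul /= egE invg1 mul1r.
Qed.

Lemma eg_crossed g : crossed S (delta (eg S K g) g).
Proof.
apply: delta_crossed; exists (cst 1); first exact: cst_CK.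
by apply/funext => p; rewrite [LHS]/GRing.mul /= mulr1.
Qed.

Lemma delta1_mul f f' : crossM S (delta f 1%g) (delta f' 1%g) = delta (f * f') 1%g.
Proof. by rewrite crossM_delta1l; apply/funext => g; rewrite /delta; case: eqP => // _; rewrite mulr0. Qed.

Variables (E00 E01 : {set vert G}).
Hypotheses (hbip : bipartite E00 E01) (hL : conditionL G) (univ : universal S).

(** The element g of the conclusion is the inverse of an element of the support
    of a, named g in the proof. *)
Lemma crossed_compression a : crossed S a -> a <> 0 ->
  exists (W : set T) (lambda : K) g, [/\ clopen W, W !=set0, lambda <> 0 &
    crossM S (crossM S (crossM S (delta \1_W 1%g) a) (delta (eg S K g) g)) (delta \1_W 1%g)
    = delta (fun p => lambda * \1_W p) 1%g].
Proof.
move=> [/finite_seqP[s sE] aD] a0.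
have [g ag] : exists g, a g <> 0.
  by apply: contrapT => H; apply: a0; apply/funext => g; apply: contrapT => h; apply: H; exists g.
have [p0 agp] : exists p, a g p <> 0.
  by apply: contrapT => H; apply: ag; apply/funext => p; apply: contrapT => h; apply: H; exists p.
have [f /locconst_continuous cf fE] := aD g.
have agE p : Ug S g p -> a g p = f p.
  by rewrite -fE [X in _ -> X = _]/GRing.mul /= egE /Ug /=; case: theta => //= *; rewrite mul1r.
have p0U : Ug S g p0.
  by move: agp; rewrite -fE [X in X <> _]/GRing.mul /= egE /Ug /=; case: theta => //; rewrite mul0r.
pose V := Ug S g `&` [set p | f p = a g p0].
have cV : clopen V by apply: clopenI; [exact: Ug_clopen|exact: (locconst_clopen [set a g p0] cf)].
have V0 : V !=set0 by exists p0; split=> //=; rewrite agE.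
(* after the shift by g^-1, the coefficient at u sits at k = u g^-1, and its
   translates are governed by k^-1 = g u^-1 *)
pose s' := [seq (g * u^-1)%g | u <- s & u != g].
have s'1 : 1%g \notin s'.
  apply/mapP => -[u]; rewrite mem_filter => /andP[/eqP ug _] E; apply: ug.
  by apply: invg_inj; apply: (mulgI g); rewrite mulgV.
have [W [cW W0 WV Ws]] := wandering_clopen hbip hL univ cV V0 s'1.
exists W, (a g p0), g^-1%g; split=> //.
apply/funext => k; apply/funext => p; rewrite compressionE invgK.
have [Wp|nWp] := pselect (W p); last first.
  have {}nWp := memNset nWp; rewrite /delta; have -> : (\1_W : T -> K) p = 0 by rewrite indicE nWp.
  rewrite [LHS](_ : _ = 0); last by do 2!case: theta => [?|] //; rewrite !mul0r.
  by case: eqP => //= _; rewrite indicE nWp mulr0.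
have [Up fp] := WV _ Wp.
have w1 : (\1_W : T -> K) p = 1 by rewrite indicE mem_set.
rewrite w1 /delta; case: eqP => [->|/eqP k1].
  rewrite mul1g invg1 theta_id w1 mulr1 mul1r agE // fp.
  move: Up; rewrite /Ug /=; case E: theta => [q|] // _.
  by have := theta_inv E; rewrite egE !invgK => ->; rewrite !mulr1.
case: theta => [q|] //; case E: theta => [r|] //.
have [->|akg] := pselect (a (k * g)%g = 0); first by rewrite mulr0 !mul0r.
have ks : k^-1%g \in s'.
  apply/mapP; exists (k * g)%g; last by rewrite invgM mulVKg.
  rewrite mem_filter; apply/andP; split.
    by apply: contraNneq k1 => e; apply/eqP/(mulIg g); rewrite mul1g.
  by have : [set` s] (k * g)%g by rewrite -sE.
have [Wr|nWr] := pselect (W r); first by case: (Ws _ _ _ ks Wp Wr).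
by rewrite [X in _ * X]indicE (memNset nWr) mulr0.
Qed.

End Compression.

Theorem theorem10p10
  (G : sepgraph) (E00 E01 : {set vert G}) (hbip : bipartite E00 E01)
  (hL : conditionL G)
  (K : fieldType) (conjK : {rmorphism K -> K}) (hconj : involutive conjK)
  (Omega : topologicalType) (S : dynsys G Omega) (hS : universal S) :
  (forall a : freegroup (edge G) -> Omega -> K, crossed S a -> a <> 0 ->
     exists (h : Omega -> K) (lambda : K) (g : freegroup (edge G)),
       [/\ projection conjK h, h <> 0, lambda <> 0
         & crossM S (crossM S (crossM S (delta h 1%g) a) (delta (eg S K g) g))
             (delta h 1%g)
           = delta (fun p => lambda * h p) 1%g]) /\
  (forall I : set (freegroup (edge G) -> Omega -> K), ideal S I ->
     (exists2 a, I a & a <> 0) ->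
     exists h : Omega -> K,
       [/\ projection conjK h, h <> 0 & I (delta h 1%g)]).
Proof.
have indic_projection (W : set Omega) : clopen W -> projection conjK (\1_W : Omega -> K).
  move=> cW; split; first exact: indic_CK.
    apply/funext => p; rewrite [LHS]/GRing.mul /= indicE.
    by case: (p \in W); rewrite ?mulr1 ?mulr0.
  by apply/funext => p /=; rewrite indicE; case: (p \in W); rewrite ?rmorph1 ?rmorph0.
have indic_neq0 (W : set Omega) : W !=set0 -> (\1_W : Omega -> K) <> 0.
  move=> [p Wp] /(congr1 (fun f => f p)); rewrite indicE mem_set // => /eqP.
  by rewrite oner_eq0.
split=> [a ca a0|I [Isub _ _ Imul] [a Ia a0]].
  have [W [lambda [g [cW W0 l0 E]]]] := crossed_compression hbip hL hS ca a0.
  by exists \1_W, lambda, g; split; [exact: indic_projection|exact: indic_neq0| |].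
have [W [lambda [g [cW W0 l0 E]]]] := crossed_compression hbip hL hS (Isub _ Ia) a0.
exists \1_W; split; [exact: indic_projection|exact: indic_neq0|].
have cW1 := delta1_crossed S (@indic_CK _ K _ cW).
have Il : I (delta (fun p => lambda * \1_W p) 1%g).
  rewrite -E; apply: (proj2 (Imul _ _ _ cW1)).
  by apply: (proj2 (Imul _ _ _ (eg_crossed S K g))); apply: (proj1 (Imul _ _ Ia cW1)).
have := proj1 (Imul _ _ Il (delta1_crossed S (@cst_CK Omega K lambda^-1))).
rewrite delta1_mul; congr (I (delta _ _)); apply/funext => p.
by rewrite [LHS]/GRing.mul /= mulrA mulVf ?mul1r //; exact/eqP.
Qed.
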